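(* Let $k\ge 1$ and $n$ be integers with $2k<n$, and let $p,q>0$ be real numbers satisfying $$\frac{1}{p+1}+\frac{1}{q+1}\le\frac{n-2k}{n}.$$ Then there exist functions $u,v$ on $\mathbb{R}^n$ solving $$(-\Delta)^k u=v^p,\qquad (-\Delta)^k v=u^q,\qquad u>0,\ v>0\qquad\text{in }\mathbb{R}^n,$$ and such that $u(x)\to 0$ and $v(x)\to 0$ uniformly as $|x|\to\infty$.
   Context: Solutions are understood in the classical sense ($u,v\in C^{2k}(\mathbb{R}^n)$, equations holding pointwise); $(-\Delta)^k$ is the $k$-fold iterate of $-\Delta$. *)

(* Defs.v *)
From HB Require Import structures.
From mathcomp Require Import all_boot all_order all_algebra.
From mathcomp Require Import all_classical all_reals all_analysis.

Set Implicit Arguments.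
Unset Strict Implicit.
Unset Printing Implicit Defensive.

Import Order.TTheory GRing.Theory Num.Theory.
Import numFieldNormedType.Exports.

Local Open Scope classical_set_scope.
Local Open Scope ring_scope.

Section EuclideanSpace.
Variables (R : realType) (n : nat).
Implicit Types f u : 'rV[R]_n -> R.

Definition basis_vec (i : 'I_n) : 'rV[R]_n := delta_mx 0 i.

Definition partial (i : 'I_n) f : 'rV[R]_n -> R := 'D_(basis_vec i) f.

(* C^m(R^n): every iterated partial derivative of order at most m exists at
   every point and is continuous. The derivability clause is essential, because
   'D_v f x is a total operator. *)
Fixpoint Cm (m : nat) f : Prop :=
  if m is m'.+1 then
    continuous f /\
    forall i : 'I_n,
      (forall x, derivable f x (basis_vec i)) /\ Cm m' (partial i f)
  else continuous f.

Definition laplacian f : 'rV[R]_n -> R :=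
  fun x => \sum_(i < n) partial i (partial i f) x.

Definition neg_laplacian f : 'rV[R]_n -> R := fun x => - laplacian f x.

Definition neg_laplacian_iter (k : nat) f : 'rV[R]_n -> R :=
  iter k neg_laplacian f.

(* The library norm `|x| on 'rV[R]_n is the sup norm, hence this definition. *)
Definition euclidean_norm (x : 'rV[R]_n) : R :=
  Num.sqrt (\sum_(i < n) x 0 i ^+ 2).

Definition vanishes_at_infinity u : Prop :=
  forall e : R, 0 < e ->
    exists M : R, forall x, M < euclidean_norm x -> `|u x| < e.

End EuclideanSpace.

(* Main.v *)
Require Import Defs.
From HB Require Import structures.
From mathcomp Require Import all_boot all_order zify.

(* Write -Delta w_i = g_i(w_{i+1}), i mod 2k, for the radial system satisfied by
   u, -Delta u, ..., (-Delta)^{k-1} u, v, ..., (-Delta)^{k-1} v, and shoot from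
   the initial values w_i(0) = a_i, where a ranges over a simplex.  On the face
   a_i = 0 component i is the first one to vanish, so the dual KKM lemma gives
   an a for which either all components vanish at the same radius T, or all are
   still nonnegative at a prescribed radius.  The Pohozaev identity on and above
   the critical hyperbola excludes the first alternative; letting the radius
   tend to infinity leaves an entire positive solution.  Each w_i is decreasing,
   and a positive lower bound for w_{i+1} would drive w_i to -oo, so all w_i
   tend to 0.

   For exponents below 1 the initial value problem is not well posed at 0.  The
   shooting is therefore done for the system with a delayed argument and a
   small extra source, which is solved by finitely many integrations and
   depends continuously on a; the delay goes to 0 together with the radius
   going to infinity, along an ultrafilter. *)

Set Implicit Arguments.
Unset Strict Implicit.
Unset Printing Implicit Defensive.

(** * A dual KKM lemma on simplex grids *)

(** The normalization that the [a i] sum to 1 is what keeps the limit nontrivial: it passes to every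
    limit, and since the system is cyclic, a single vanishing initial value would propagate to all
    of them. The extra source serves strict monotonicity: a component decreases even if its
    neighbour starts at 0, so the radius of first vanishing does not depend on the component chosen
    to witness it. The shooting conditions are closed, hence survive limits; one ultrafilter
    replaces repeated extraction of subsequences. The Pohozaev function vanishes at 0 and does not
    increase under the hypothesis on p and q, while at a common zero only products of radial
    derivatives remain in it, and these are positive. The radial Laplacian never appears with its
    singular coefficient 1/r: everything goes through w' = -r G, where G is a weighted average of
    the source that is even and as smooth as the source, also at the origin. *)

Lemma card_doubled_fiber (T T' : finType) (f : T -> T') (A : {set T}) :
  #|A| = #|f @: A|.+1 -> #|[set x in A | f x \in f @: (A :\ x)]| = 2.
Proof.
move=> cardA.
have /dinjectivePn [x1 x1A [x2 /andP[/= nx x2A] fx]] : ~~ dinjectiveb f [in A].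
  apply/negP => /dinjectiveP finj.
  by move: cardA; rewrite card_in_imset // => /n_Sn.
have x2A1 : x2 \in A :\ x1 by rewrite !inE nx.
have fA : f @: (A :\ x1) = f @: A.
  apply/setP=> y; apply/imsetP/imsetP=> -[x xA ->].
    by exists x => //; case/setD1P: xA.
  by have [->|nx1] := eqVneq x x1; [exists x2|exists x => //; rewrite !inE nx1].
(* Removing [x1] leaves the image unchanged and makes the cardinalities equal, so [x1], [x2] is the
   only collision. *)
have /imset_injP finj : #|f @: (A :\ x1)| == #|A :\ x1|.
  by rewrite fA -eqSS -cardA (cardsD1 x1 A) x1A.
suff -> : [set x in A | f x \in f @: (A :\ x)] = [set x1; x2].
  by rewrite cards2 eq_sym nx.
apply/setP=> x; rewrite !inE; apply/andP/orP => [[xA /imsetP[z /setD1P[zx zA]]]|].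
  move=> fxz; have [->|nxx1] := eqVneq x x1; first by left.
  right; have [zx1|nzx1] := eqVneq z x1.
    apply/eqP; apply: (finj x x2); rewrite ?x2A1 //; first by rewrite !inE nxx1.
    by rewrite fxz zx1.
  by case/eqP: zx; apply: (finj z x); rewrite // !inE ?nxx1 ?nzx1.
case=> /eqP ->; split=> //.
  by rewrite fx; apply: imset_f.
by rewrite -fx; apply: imset_f; rewrite !inE x1A andbT eq_sym.
Qed.

(* Scarf's substitute for a triangulation: the faces are the sets [Z] whose
   minima cannot be exceeded in all the orders [key i] simultaneously.  The
   points [s i] below, least for [key i] and greatest for the other orders, are
   the vertices of the simplex. *)
Definition dominant (I X : finType) (key : I -> X -> nat) (Z : {set X}) :=
  [forall x, exists i, [forall z in Z, key i x <= key i z]].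

Lemma dominantP (I X : finType) (key : I -> X -> nat) (Z : {set X}) :
  reflect (forall x, exists i, forall z, z \in Z -> key i x <= key i z)
          (dominant key Z).
Proof.
apply: (iffP forallP) => H x.
  by have /existsP[i /forall_inP Hi] := H x; exists i.
by have [i Hi] := H x; apply/existsP; exists i; apply/forall_inP.
Qed.

Lemma dominantS (I X : finType) (key : I -> X -> nat) (Z Y : {set X}) :
  Z \subset Y -> dominant key Y -> dominant key Z.
Proof.
move=> /subsetP ZY /dominantP H; apply/dominantP => x.
by have [i Hi] := H x; exists i => z /ZY; apply: Hi.
Qed.

Definition extensions (I X : finType) (key : I -> X -> nat) (Z : {set X}) :=
  [set x | (x \notin Z) && dominant key (x |: Z)].

(** Scarf's replacement step. Each point of the dominant set [Z] is least in some order, so [mu]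
    maps [#|I|] orders onto [#|I|.-1] points and exactly two orders share their minimum. A new point
    has to take over one of these two: it lies above the minima in all other orders and is the
    greatest such point in its own, which leaves one candidate per order. *)
Lemma card_extensions (I X : finType) (key : I -> X -> nat) (s : I -> X)
    (c : X -> I) (i0 : I) (Z : {set X}) :
  (forall i, injective (key i)) ->
  (forall i x, x != s i -> key i (s i) < key i x) ->
  (forall i j x, i != j -> x \notin codom s -> key i x < key i (s j)) ->
  cancel s c ->
  dominant key Z -> c @: Z = ~: [set i0] -> #|Z| = #|I|.-1 ->
  Z != s @: (~: [set i0]) -> #|extensions key Z| = 2.
Proof.
move=> keyI slo shi cs dZ cZ cardZ nZ.
have sI := can_inj cs.
have [z0 z0Z] : exists z, z \in Z.
  have [Z0|[z zZ]] := set_0Vmem Z; last by exists z.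
  case/eqP: nZ; rewrite -cZ Z0 !imset0 //.
pose mu i := [arg min_(z < z0 in Z) key i z].
have muZ i : mu i \in Z by rewrite /mu; case: arg_minnP.
have mumin i z : z \in Z -> key i (mu i) <= key i z.
  by rewrite /mu; case: arg_minnP => // ? _; apply.
have muE i z : z \in Z -> (forall z', z' \in Z -> key i z <= key i z') -> mu i = z.
  by move=> zZ zmin; apply: (keyI i); apply/eqP; rewrite eqn_leq mumin //= zmin.
have muim : mu @: setT = Z.
  apply/setP=> z; apply/imsetP/idP => [[i _ ->] //|zZ].
  by have /dominantP/(_ z)[i zi] := dZ; exists i => //; rewrite (muE i z).
set Red := [set i in setT | mu i \in mu @: (setT :\ i)].
have cardRed : #|Red| = 2.
  by apply: card_doubled_fiber; rewrite muim cardZ cardsT prednK //; apply/card_gt0P; exists i0.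
pose A i := [pred x | [forall (m | m != i), key m (mu m) < key m x]].
have AP i x : reflect (forall m, m != i -> key m (mu m) < key m x) (x \in A i).
  exact: forall_inP.
(* [A i] is nonempty because [Z] is not the outer face: a minimum [s l] in a foreign order leaves no
   grid point in [Z], and then the colours force [Z] to be that face. *)
have sA i : s i \in A i.
  apply/AP => m mi.
  have [/codomP[l ml]|ns] := boolP (mu m \in codom s); last exact: shi.
  have [lm|nlm] := eqVneq l m.
    by rewrite ml lm; apply: slo; rewrite (inj_eq sI) eq_sym.
  case/eqP: nZ; have Zs z : z \in Z -> z \in codom s.
    move=> zZ; apply/negPn/negP=> ns.
    have := mumin m z zZ; rewrite ml leqNgt shi // eq_sym //.
  apply/setP=> z; apply/idP/imsetP => [zZ|[j]].
    have /codomP[j zj] := Zs z zZ; exists j => //.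
    by rewrite -cZ; apply/imsetP; exists z; rewrite // zj cs.
  rewrite -cZ => /imsetP[z' z'Z ->] ->.
  by have /codomP[j' zj'] := Zs z' z'Z; rewrite zj' cs -zj'.
pose xi i := [arg max_(x > s i in A i) key i x].
have xiA i : xi i \in A i by rewrite /xi; case: arg_maxnP => //; apply: sA.
have ximax i x : x \in A i -> key i x <= key i (xi i).
  by rewrite /xi; case: arg_maxnP; [apply: sA|move=> ? _; apply].
suff -> : extensions key Z = xi @: Red.
  (* The two candidates differ: a point serving both orders would exceed the minimum of [Z] in every
     order. *)
  rewrite card_in_imset ?cardRed // => i j iR jR xij.
  apply/eqP/negPn/negP => nij.
  have /dominantP/(_ (xi i))[m /(_ _ (muZ m))] := dZ; rewrite leqNgt.
  have [mi|nmi] := eqVneq m i; last by rewrite (AP _ _ (xiA i)).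
  by rewrite xij (AP _ _ (xiA j)) // mi.
apply/setP => x; rewrite inE; apply/andP/imsetP; last first.
  case=> i; rewrite inE => /andP[_ /imsetP[j /setD1P[nji _] muij]] ->.
  have /dominantP dZ' := dZ.
  have xiZ : xi i \notin Z.
    apply/negP=> xZ; have [m Hm] := dZ' (xi i).
    have [mi|nmi] := eqVneq m i; last first.
      by have := Hm _ (muZ m); rewrite leqNgt (AP _ _ (xiA i)).
    move: (muE m _ xZ Hm); rewrite mi muij => E.
    by have /AP/(_ j nji) := xiA i; rewrite E ltnn.
  split=> //; apply/dominantP => x'.
  have [l Hl] := dZ' x'.
  have [x'A|] := boolP (x' \in A i).
    have li : l = i.
      apply/eqP/negPn/negP=> nli; have := Hl _ (muZ l).
      by rewrite leqNgt (AP _ _ x'A).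
    exists i => z; rewrite !inE => /orP[/eqP ->|]; first exact: ximax.
    by rewrite -li; apply: Hl.
  rewrite inE => /forall_inPn [m nmi]; rewrite -leqNgt => Hm.
  exists m => z; rewrite !inE => /orP[/eqP ->|zZ].
    by apply: leq_trans Hm _; apply: ltnW; apply: (AP _ _ (xiA i)).
  exact: leq_trans Hm (mumin _ _ zZ).
move=> [xZ /dominantP dxZ].
pose nu z := odflt i0 [pick i | [forall y in x |: Z, key i z <= key i y]].
have Hnu z y : y \in x |: Z -> key (nu z) z <= key (nu z) y.
  rewrite /nu; case: pickP => [i /forall_inP H /H //|Hn].
  by have [i /forall_inP Hi] := dxZ z; have := Hn i; rewrite Hi.
have munu z : z \in Z -> mu (nu z) = z.
  by move=> zZ; apply: muE => // z' z'Z; apply: Hnu; rewrite !inE z'Z orbT.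
have nux z : z \in Z -> key (nu z) z < key (nu z) x.
  move=> zZ; rewrite ltn_neqAle Hnu ?setU11 // andbT.
  by apply/eqP=> /keyI zx; rewrite zx (negPf xZ) in zZ.
have xA : x \in A (nu x).
  (* If [x] were low in a second order [m], [nu] would embed [Z] into the orders other than [nu x]
     and [m], which are too few. *)
  apply/AP => m nm; rewrite ltnNge; apply/negP => xm.
  have : #|nu @: Z| <= #|~: [set nu x; m]|.
    apply/subset_leq_card/subsetP => _ /imsetP[z zZ ->]; rewrite !inE negb_or.
    apply/andP; split; apply/eqP => E.
      by have := nux _ zZ; rewrite E ltnNge Hnu // !inE zZ orbT.
    by have := nux _ zZ; rewrite E ltnNge -(munu _ zZ) E xm.
  rewrite card_in_imset => [|z z' zZ z'Z E]; last by rewrite -(munu z) // E munu.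
  rewrite cardZ; have := cardsC [set nu x; m]; rewrite cards2 eq_sym nm => <-.
  by rewrite addSn add1n /= ltnn.
have xmax x' : x' \in A (nu x) -> key (nu x) x' <= key (nu x) x.
  move=> /AP x'A; have [m Hm] := dxZ x'.
  have [<-|nm] := eqVneq m (nu x); first by rewrite Hm ?setU11.
  by have := Hm (mu m); rewrite !inE muZ orbT leqNgt x'A // => /(_ isT).
exists (nu x); last by apply: (keyI (nu x)); apply/eqP; rewrite eqn_leq ximax //= xmax.
(* [nu x] is one of the two shared orders: its minimum over [Z] is also least in another order, the
   one that [nu] assigns to that point. *)
rewrite inE in_setT /=; apply/imsetP; exists (nu (mu (nu x))); last by rewrite (munu (mu (nu x))) ?muZ.
rewrite !inE andbT; apply/eqP => E.
by have := nux _ (muZ (nu x)); rewrite E ltnNge Hnu // !inE muZ orbT.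
Qed.

(** The outer face is the exception in the parity count, having the simplex on one side only. Its
    single extension is the non-slack point that is greatest in the order [i0]. *)
Lemma card_extensions_slack (I X : finType) (key : I -> X -> nat) (s : I -> X)
    (i0 : I) (x0 : X) :
  (forall i, injective (key i)) ->
  (forall i x, x != s i -> key i (s i) < key i x) ->
  (forall i j x, i != j -> x \notin codom s -> key i x < key i (s j)) ->
  injective s -> x0 \notin codom s ->
  dominant key (s @: (~: [set i0])) /\
  #|extensions key (s @: (~: [set i0]))| = 1.
Proof.
move=> keyI slo shi sI x0s.
have slo' i x : key i (s i) <= key i x.
  by have [->//|/(slo i)/ltnW] := eqVneq x (s i).
have [x1 x1s x1max] : exists2 x, x \notin codom s &
    forall y, y \notin codom s -> key i0 y <= key i0 x.
  by case: (@arg_maxnP X x0 (fun x => x \notin codom s) (key i0)) => // x; exists x.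
have x1Z : x1 \notin s @: (~: [set i0]).
  by apply: contra x1s => /imsetP[j _ ->]; apply: codom_f.
have dom1 : dominant key (x1 |: s @: (~: [set i0])).
  apply/dominantP => x; have [/codomP[l ->]|xs] := boolP (x \in codom s).
    by exists l => z _.
  exists i0 => z /setU1P[->|/imsetP[j]]; first exact: x1max.
  by rewrite !inE eq_sym => ji ->; apply/ltnW/shi.
split; first by apply: dominantS dom1; apply: subsetUr.
suff -> : extensions key (s @: (~: [set i0])) = [set x1] by rewrite cards1.
apply/setP=> x; rewrite !inE; apply/andP/eqP => [[xZ /dominantP dx]|->//].
have key0 y : y \notin codom s -> key i0 y <= key i0 x.
  move=> ys; have [m Hm] := dx y.
  have [<-|nm] := eqVneq m i0; first by rewrite Hm ?setU11.
  have : key m y <= key m (s m).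
    by apply: Hm; rewrite !inE imset_f ?orbT // !inE.
  rewrite leqNgt slo //; apply: contra ys => /eqP ->; exact: codom_f.
have [/codomP[l xl]|xs] := boolP (x \in codom s).
  have [li|nl] := eqVneq l i0; last by rewrite xl imset_f // !inE in xZ.
  have := key0 _ x0s; rewrite xl li leqNgt slo //.
  by apply: contra x0s => /eqP ->; apply: codom_f.
by apply: (keyI i0); apply/eqP; rewrite eqn_leq x1max // key0.
Qed.

(** The parity proof of Sperner's lemma. Incidences between doors (faces with every colour but [i0])
    and cells are counted in two ways: from the doors the number is odd, since only [Z0] has a
    single extension, whereas a cell that is not fully coloured contributes 0 or 2. *)
Lemma fully_coloured_dominant (I X : finType) (key : I -> X -> nat) (s : I -> X)
    (c : X -> I) (i0 : I) (x0 : X) :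
  (forall i, injective (key i)) ->
  (forall i x, x != s i -> key i (s i) < key i x) ->
  (forall i j x, i != j -> x \notin codom s -> key i x < key i (s j)) ->
  cancel s c -> x0 \notin codom s ->
  exists Y : {set X}, dominant key Y /\ c @: Y = setT.
Proof.
move=> keyI slo shi cs x0s; have sI := can_inj cs.
pose C0 := ~: [set i0]; pose Z0 := s @: C0.
pose door (Z : {set X}) := [&& dominant key Z, c @: Z == C0 & #|Z| == #|I|.-1].
pose cell (Y : {set X}) := dominant key Y && (#|Y| == #|I|).
have I0 : 0 < #|I| by apply/card_gt0P; exists i0.
have [dZ0 eZ0] := card_extensions_slack i0 keyI slo shi sI x0s.
have doorZ0 : door Z0.
  rewrite /door dZ0 /=; apply/andP; split; last first.
    by rewrite card_imset // cardsC1.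
  by rewrite -imset_comp (eq_imset _ cs) imset_id.
have [Y /andP[/andP[dY _] /eqP cY]|nfull] :=
    pickP [pred Y : {set X} | cell Y && (c @: Y == setT)]; first by exists Y.
have : odd (\sum_(Z | door Z) #|extensions key Z|).
  rewrite (bigD1 Z0) //= eZ0 oddD /=.
  elim/big_ind: _ => [//|m n|Z /andP[/and3P[dZ /eqP cZ /eqP nZ] ZZ0]].
    by rewrite oddD; case: (odd m); case: (odd n).
  by rewrite (card_extensions keyI slo shi cs dZ cZ nZ ZZ0).
have -> : \sum_(Z | door Z) #|extensions key Z| =
    \sum_(Y | cell Y) #|[set x in Y | c @: (Y :\ x) == C0]|.
  under eq_bigr do rewrite -sum1_card.
  under [RHS]eq_bigr do rewrite -sum1_card.
  rewrite (exchange_big_dep predT) //= [RHS](exchange_big_dep predT) //=.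
  apply: eq_bigr => x _.
  rewrite (reindex_onto (fun Y => Y :\ x) (fun Z => x |: Z)) /=; last first.
    by move=> Z /andP[_]; rewrite inE => /andP[xZ _]; rewrite setU1K.
  apply: eq_bigl => Y; rewrite !inE eqxx /=.
  have [xY|xY] := boolP (x \in Y); last first.
    rewrite andbF; apply/negP=> /andP[_ /eqP E].
    by rewrite -E setU11 in xY.
  rewrite setD1K // eqxx andbT /= /door /cell.
  have := cardsD1 x Y; rewrite xY add1n => cY.
  apply/idP/idP => [/andP[/and3P[_ -> /eqP nY] ->]|/andP[/andP[dY /eqP nY] ->]].
    by rewrite cY nY prednK // eqxx.
  by rewrite dY (dominantS _ dY) ?subsetDl // -nY cY /= eqxx.
move=> od; exfalso; move: od; apply/negP.
elim/big_ind: _ => [//|m n|Y cellY].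
  by rewrite oddD; case: (odd m); case: (odd n).
have [->|[x]] := set_0Vmem [set x in Y | c @: (Y :\ x) == C0]; first by rewrite cards0.
rewrite inE => /andP[xY /eqP cYx].
have cY : c @: Y = C0.
  apply/eqP; rewrite eqEsubset; apply/andP; split; last first.
    by rewrite -cYx imsetS ?subsetDl.
  apply/subsetP=> i iY.
  rewrite !inE; apply/eqP=> ii0; have := nfull Y; rewrite inE cellY /=.
  case/negP; apply/eqP/setP=> j; rewrite inE.
  have [->|nj] := eqVneq j i0; first by rewrite -ii0.
  have : j \in C0 by rewrite !inE.
  by rewrite -cYx => /imsetP[y /setD1P[_ yY] ->]; apply: imset_f.
(* In a cell with colours exactly [C0], a point can be removed without losing a colour iff its
   colour occurs twice. *)
have -> : [set y in Y | c @: (Y :\ y) == C0] = [set y in Y | c y \in c @: (Y :\ y)].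
  apply/setP=> y; rewrite !inE; case yY: (y \in Y) => //=.
  apply/eqP/idP => [->|]; first by rewrite -cY imset_f.
  move=> /imsetP[z /setD1P[zy zY] cyz]; rewrite -cY.
  apply/setP=> i; apply/imsetP/imsetP => [[w /setD1P[_ wY] ->]|[w wY ->]].
    by exists w.
  have [wy|nwy] := eqVneq w y; last by exists w; rewrite // !inE nwy.
  by exists z; rewrite ?wy // !inE zy.
rewrite card_doubled_fiber // cY cardsC1 prednK //.
by case/andP: cellY => _ /eqP.
Qed.

(** The shift by one puts grid points on levels 1 to [N.+1], strictly between the own slack point
    (level 0) and the other slack points (level [N.+2]), as Scarf's argument requires. *)
Definition grid_level (d N : nat) (i : 'I_d)
    (z : {x : {ffun 'I_d -> 'I_N.+1} | \sum_j val (x j) == N} + 'I_d) : nat :=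
  match z with
  | inl x => (val x i).+1
  | inr j => if j == i then 0 else N.+2
  end.

(* [C] is the set of colours that occur.  A colour [l] outside [C] is made up for
   by the coordinate [l] being small on all the points [y i]. *)
Lemma grid_colouring (d N : nat)
    (c : {x : {ffun 'I_d.+1 -> 'I_N.+1} | \sum_j val (x j) == N} -> 'I_d.+1) :
  exists (C : {set 'I_d.+1}) y,
    [/\ C != set0, forall i, i \in C -> c (y i) = i,
     forall i j l, i \in C -> j \in C -> val (y i) l <= val (y j) l + d.+1 &
     forall i l, i \in C -> l \notin C -> val (y i) l <= d.+1].
Proof.
pose G := {x : {ffun 'I_d.+1 -> 'I_N.+1} | \sum_j val (x j) == N}.
pose mkG (x : {ffun 'I_d.+1 -> 'I_N.+1}) (xN : \sum_j val (x j) == N) : G :=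
  exist _ x xN.
pose X := (G + 'I_d.+1)%type.
pose lev (i : 'I_d.+1) (z : X) := @grid_level d.+1 N i z.
(* Ties between equal levels are broken by the enumeration rank, which makes every order
   injective. *)
pose key i z := lev i z * #|{: X}| + val (enum_rank z).
have rlt (z : X) : val (enum_rank z) < #|{: X}| by apply: ltn_ord.
have keylt i z z' : lev i z < lev i z' -> key i z < key i z'.
  move=> h; rewrite /key; apply: (@leq_trans ((lev i z).+1 * #|{: X}|)).
    by rewrite mulSn addnC ltn_add2r.
  by apply: leq_trans (leq_addr _ _); rewrite leq_mul2r h orbT.
have keyI i : injective (key i).
  move=> z z' /(congr1 (fun m => m %% #|{: X}|)).
  by rewrite /key !modnMDl !modn_small // => /val_inj /enum_rank_inj.
pose s (i : 'I_d.+1) : X := inr i.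
have slo i x : x != s i -> key i (s i) < key i x.
  move=> nx; apply: keylt; rewrite /lev /= eqxx.
  case: x nx => [//|j] nj; rewrite /=.
  by case: (eqVneq j i) nj => [->|//]; rewrite eqxx.
have shi i j x : i != j -> x \notin codom s -> key i x < key i (s j).
  move=> ij xs; apply: keylt; rewrite /lev /= eq_sym (negPf ij).
  case: x xs => [x _|k]; last by rewrite -/(s k) codom_f.
  by rewrite /lev /= ltnS ltn_ord.
pose c' (z : X) := match z with inl x => c x | inr i => i end.
have x0P : \sum_j val ([ffun j : 'I_d.+1 => if j == ord0 then ord_max : 'I_N.+1 else ord0] j) == N.
  rewrite (bigD1 ord0) //= ffunE eqxx big1 ?addn0 // => i ni.
  by rewrite ffunE (negPf ni).
have x0s : inl (mkG _ x0P) \notin codom s by apply/negP => /codomP[].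
have [Y [/dominantP dY cY]] := fully_coloured_dominant ord0 keyI slo shi
  (fun i => erefl : c' (s i) = i) x0s.
pose C := [set i | s i \notin Y].
have [y Hy] : exists y, forall i, i \in C -> c (y i) = i /\ inl (y i) \in Y.
  have H i : exists x, (i \in C) ==> (c x == i) && (inl x \in Y).
    have [iC|_] := boolP (i \in C); last by exists (mkG _ x0P).
    have : i \in c' @: Y by rewrite cY.
    case/imsetP => -[x xY /= ->|j jY /= ij]; first by exists x; rewrite eqxx.
    by rewrite inE ij jY in iC.
  exists (fun i => xchoose (H i)) => i iC.
  by have /implyP/(_ iC)/andP[/eqP] := xchooseP (H i).
have C_y l : l \notin C -> s l \in Y by rewrite inE negbK.
have [l0 l0C] : exists l, l \in C.
  have [i Hi] := dY (inl (mkG _ x0P)); exists i; rewrite inE; apply/negP=> /Hi.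
  by rewrite leqNgt slo.
pose mu l := lev l [arg min_(z < (inl (y l) : X) in Y) lev l z].
have mule l z : l \in C -> z \in Y -> mu l <= lev l z.
  by move=> /Hy[_ yY]; rewrite /mu; case: arg_minnP => // w _; apply.
have muge l : l \in C -> exists2 z, z \in Y & lev l z = mu l.
  by move=> /Hy[_ yY]; rewrite /mu; case: arg_minnP => // w wY _; exists w.
(* Otherwise take the grid point with coordinates [mu l] on [C] minus [l0], 0 outside [C], and the
   remainder at [l0]. Because of the shift in the levels it lies above [mu l] for every [l] in [C],
   against dominance of [Y]. *)
have muC : N < \sum_(l in C) mu l.
  rewrite ltnNge; apply/negP => sumle.
  have sum1 : \sum_(l in C :\ l0) mu l <= N.
    apply: leq_trans sumle; rewrite [X in _ <= X](bigD1 l0) //=.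
    apply: leq_trans (leq_addl _ _); rewrite leq_eqVlt; apply/orP; left; apply/eqP.
    by apply: eq_bigl => i; rewrite !inE andbC.
  pose f (l : 'I_d.+1) := if l == l0 then N - \sum_(l in C :\ l0) mu l
    else if l \in C then mu l else 0.
  have fsum : \sum_l f l = N.
    rewrite (bigD1 l0) //= {1}/f eqxx.
    suff -> : \sum_(i < d.+1 | i != l0) f i = \sum_(l in C :\ l0) mu l by rewrite subnK.
    rewrite [RHS](eq_bigl (fun l => (l != l0) && (l \in C))); last by move=> l; rewrite !inE.
    rewrite [RHS]big_mkcondr /=; apply: eq_bigr => l nl.
    by rewrite /f (negPf nl).
  have fle l : f l < N.+1 by rewrite ltnS -fsum (bigD1 l) //= leq_addr.
  have xP : \sum_j val ([ffun j : 'I_d.+1 => Ordinal (fle j)] j) == N.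
    by apply/eqP; rewrite -[RHS]fsum; apply: eq_bigr => j _; rewrite ffunE.
  have [l Hl] := dY (inl (mkG _ xP)).
  have [lC|/C_y lY] := boolP (l \in C); last by have := Hl _ lY; rewrite leqNgt slo.
  have [z zY zl] := muge _ lC.
  have := Hl _ zY; rewrite leqNgt keylt // zl /lev /= ffunE /= ltnS /f lC.
  case: eqVneq => [->|//]; rewrite leq_subRL // addnC.
  apply: leq_trans sumle; rewrite [X in _ <= X](bigD1 l0) //= leq_add2l.
  by rewrite leq_eqVlt; apply/orP; left; apply/eqP; apply: eq_bigl => i; rewrite !inE andbC.
(* Each [mu j] is at most the coordinate [j] of [y i] plus one, and the coordinates add up to [N].
   Combined with [muC] this bounds the spread in every coordinate. *)
have key_bound i l : i \in C -> val (val (y i) l) + \sum_(j in C :\ l) mu j <= N + d.+1.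
  move=> iC; have /eqP yN := valP (y i).
  have [_ yY] := Hy _ iC.
  have : \sum_(j in C :\ l) mu j <= \sum_(j in C :\ l) (val (val (y i) j)).+1.
    apply: leq_sum => j /setD1P[_ jC]; exact: (mule j (inl (y i)) jC yY).
  under [X in _ <= X]eq_bigr do rewrite -addn1.
  rewrite big_split /= sum1_card => h.
  suff : val (val (y i) l) + \sum_(j in C :\ l) mu j <=
      \sum_j val (val (y i) j) + d.+1 by rewrite yN.
  rewrite [X in _ <= X + _](bigD1 l) //= -addnA leq_add2l.
  apply: leq_trans h _; apply: leq_add; last by apply: leq_trans (max_card _) _; rewrite card_ord.
  rewrite (eq_bigl (fun j => (j != l) && (j \in C))); last by move=> j; rewrite !inE.
  by rewrite big_mkcondr /= leq_sum // => j _; case: ifP.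
have outC i l : i \in C -> l \notin C -> val (val (y i) l) <= d.+1.
  move=> iC lC; have := key_bound i l iC; have -> : C :\ l = C.
    by apply/setDidPl; rewrite disjoint_sym disjoints1.
  by move: muC; lia.
exists C, y; split=> //.
- by apply/set0Pn; exists l0.
- by move=> i iC; case: (Hy i iC).
move=> i j l iC jC; have [lC|lC] := boolP (l \in C); last first.
  by apply: leq_trans (leq_addl _ _); apply: outC.
have := key_bound i l iC; have [_ /(mule l _ lC) /=] := Hy _ jC.
move: muC; rewrite (bigD1 l) //=.
rewrite (eq_bigl (fun j => j \in C :\ l)); last by move=> j'; rewrite !inE andbC.
move: (\sum_(j0 in C :\ l) mu j0) (mu l) => S m.
by move: (nat_of_ord _) (nat_of_ord _); lia.
Qed.

From mathcomp Require Import all_algebra.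
From mathcomp Require Import all_classical all_reals all_analysis.
From mathcomp Require Import ring lra.

Import Order.TTheory GRing.Theory Num.Theory.
Import numFieldNormedType.Exports.

Local Open Scope classical_set_scope.
Local Open Scope ring_scope.

(** * Radial averages and the radial Poisson equation *)

Lemma derive_nondecr (R : realType) (f df : R -> R) (a b : R) : a <= b ->
  (forall x, a <= x <= b -> {for x, continuous f}) ->
  (forall x, a < x < b -> is_derive x 1 f (df x)) ->
  (forall x, a < x < b -> 0 <= df x) -> f a <= f b.
Proof.
rewrite le_eqVlt => /orP[/eqP->//|ab] fc fd dfge0.
have fw : {within `[a, b], continuous f}.
  by apply: continuous_in_subspaceT => x; rewrite inE /= in_itv /=; exact: fc.
have fd' x : x \in `]a, b[ -> is_derive x 1 f (df x) by rewrite in_itv; exact: fd.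
have [c /[!in_itv]/= cab E] := MVT ab fd' fw.
by rewrite -subr_ge0 E mulr_ge0 ?dfge0 // subr_ge0 ltW.
Qed.

Lemma derive_incr (R : realType) (f df : R -> R) (a b : R) : a < b ->
  (forall x, a <= x <= b -> {for x, continuous f}) ->
  (forall x, a < x < b -> is_derive x 1 f (df x)) ->
  (forall x, a < x < b -> 0 < df x) -> f a < f b.
Proof.
move=> ab fc fd dfge0.
have fw : {within `[a, b], continuous f}.
  by apply: continuous_in_subspaceT => x; rewrite inE /= in_itv /=; exact: fc.
have fd' x : x \in `]a, b[ -> is_derive x 1 f (df x) by rewrite in_itv; exact: fd.
have [c /[!in_itv]/= cab E] := MVT ab fd' fw.
by rewrite -subr_gt0 E mulr_gt0 ?dfge0 // subr_gt0.
Qed.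

Lemma is_derive_continuous (R : realType) (f : R -> R) (x l : R) :
  is_derive x 1 f l -> {for x, continuous f}.
Proof. by case=> fd _; apply/differentiable_continuous/derivable1_diffP. Qed.

Lemma derive_add (R : realType) (f g : R -> R) (x a b : R) :
  is_derive x 1 f a -> is_derive x 1 g b ->
  is_derive x 1 (fun t => f t + g t) (a + b).
Proof. exact: is_deriveD. Qed.

Lemma derive_sub (R : realType) (f g : R -> R) (x a b : R) :
  is_derive x 1 f a -> is_derive x 1 g b ->
  is_derive x 1 (fun t => f t - g t) (a - b).
Proof. exact: is_deriveB. Qed.

Lemma derive_mul (R : realType) (f g : R -> R) (x a b : R) :
  is_derive x 1 f a -> is_derive x 1 g b ->
  is_derive x 1 (fun t => f t * g t) (a * g x + f x * b).
Proof. by move=> fa gb; rewrite addrC [a * _]mulrC; apply: is_deriveM. Qed.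

Lemma derive_scale (R : realType) (f : R -> R) (c x a : R) :
  is_derive x 1 f a -> is_derive x 1 (fun t => c * f t) (c * a).
Proof. exact: is_deriveZ. Qed.

Lemma derive_pow (R : realType) (n : nat) (x : R) :
  is_derive x 1 (fun t : R => t ^+ n.+1) (n.+1%:R * x ^+ n).
Proof.
elim: n => [|n IH].
  by under eq_fun do rewrite expr1; rewrite mulr1; apply: is_derive_id.
under eq_fun do rewrite exprS.
apply: is_derive_eq (derive_mul (is_derive_id x 1) IH) _ => /=.
by rewrite mul1r exprS -[in RHS]natr1; ring.
Qed.

Lemma derive_same (R : realType) (f g df : R -> R) (a b : R) : a <= b ->
  (forall x, a <= x <= b -> is_derive x 1 f (df x)) ->
  (forall x, a <= x <= b -> is_derive x 1 g (df x)) -> f b - f a = g b - g a.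
Proof.
move=> ab fd gd.
have D (u v : R -> R) : (forall x, a <= x <= b -> is_derive x 1 u (df x)) ->
    (forall x, a <= x <= b -> is_derive x 1 v (df x)) -> u a - v a <= u b - v b.
  move=> ud vd.
  have Dd x : a <= x <= b -> is_derive x 1 (u - v) 0.
    by move=> xab; rewrite -(subrr (df x)); apply: is_deriveB; [exact: ud|exact: vd].
  apply: (@derive_nondecr R (u - v) (fun=> 0)) => // x xab.
    exact: is_derive_continuous (Dd x xab).
  by apply: Dd; case/andP: xab => *; rewrite !ltW.
have h1 := D _ _ fd gd; have h2 := D _ _ gd fd; lra.
Qed.

(** Integrals from -1 give a primitive to the right of -1 only; the other half comes from the
    reflected function, and the two agree on (-1, 1). A primitive on the whole line makes
    derivatives at 0 two-sided. *)
Lemma ex_primitive (R : realType) (F : R -> R) : continuous F ->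
  exists P : R -> R, P 0 = 0 /\ forall x : R, is_derive x 1 P (F x).
Proof.
move=> Fc.
have right (G : R -> R) : continuous G ->
    exists P : R -> R, P 0 = 0 /\ forall x : R, -1 < x -> is_derive x 1 P (G x).
  move=> Gc.
  pose P0 x := (\int[lebesgue_measure]_(t in `[-1, x]) G t)%R.
  exists (fun x => P0 x - P0 0); split; first by rewrite subrr.
  move=> x x1.
  have [||||D1 D2] := @continuous_FTC1 R G (BLeft (-1)) x (x + 1).
  - by rewrite ltrDl.
  - apply: continuous_compact_integrable; first exact: segment_compact.
    exact: continuous_subspaceT.
  - by rewrite lte_fin.
  - exact: Gc.
  have : is_derive x 1 P0 (G x) by apply: (DeriveDef D1); rewrite -D2 derive1E.
  move=> P0d; rewrite -[G x]subr0; apply: is_deriveB.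
have [P [P00 Pd]] := right F Fc.
have [|Q [Q00 Qd]] := right (fun x => F (- x)).
  by move=> x; apply: continuous_comp; [exact: opp_continuous|exact: Fc].
have Qd' (x : R) : x < 1 -> is_derive x 1 (fun x => - Q (- x)) (F x).
  move=> x1; have Qx : is_derive (- x) 1 Q (F x) by rewrite -{2}[x]opprK; apply: Qd; rewrite ltrN2.
  have Nx : is_derive x 1 (fun y : R => - y) (-1) by apply: is_deriveN.
  have := is_derive1_comp Qx Nx.
  by move=> /is_deriveN; rewrite mulrN1 opprK.
have PQ (x : R) : -1 < x < 1 -> P x = - Q (- x).
  move=> x1; have [x0|x0] := leP 0 x.
    have : P x - P 0 = - Q (- x) - (- Q (- 0)).
      apply: (@derive_same R P (fun x => - Q (- x)) F 0 x x0) => y yx.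
        by apply: Pd; lra.
      by apply: Qd'; lra.
    by rewrite P00 oppr0 Q00; lra.
  have : P 0 - P x = - Q (- 0) - (- Q (- x)).
    apply: (@derive_same R P (fun x => - Q (- x)) F x 0 (ltW x0)) => y yx.
      by apply: Pd; lra.
    by apply: Qd'; lra.
  by rewrite P00 oppr0 Q00; lra.
exists (fun x => if 0 <= x then P x else - Q (- x)); split; first by rewrite lexx.
move=> x; have [x0|x0] := ltP (-1) x.
  apply: (@near_eq_is_derive _ _ _ P) => //; last exact: Pd.
  near=> y; case: ifPn => // y0; rewrite PQ //.
  have : -1 < y by near: y; exact: lt_nbhsr.
  by move: y0; rewrite -ltNge => y0; lra.
apply: (@near_eq_is_derive _ _ _ (fun x => - Q (- x))) => //; last by apply: Qd'; lra.
near=> y; case: ifPn => // y0; have : y < 0 by near: y; apply: lt_nbhsl; lra.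
by lra.
Unshelve. all: by end_near.
Qed.

Definition primitive (R : realType) (F : R -> R) : R -> R :=
  xget (fun=> 0) [set P : R -> R | P 0 = 0 /\ forall x : R, is_derive x 1 P (F x)].

Lemma primitiveP (R : realType) (F : R -> R) : continuous F ->
  primitive F 0 = 0 /\ forall x : R, is_derive x 1 (primitive F) (F x).
Proof.
move=> Fc; rewrite /primitive; case: xgetP => [P _ []//|H].
by have [P HP] := ex_primitive Fc; case: (H P).
Qed.

Definition flux (R : realType) (n : nat) (f : R -> R) : R -> R :=
  primitive (fun t => t ^+ n * f t).

Lemma weight_continuous (R : realType) (n : nat) (f : R -> R) :
  continuous f -> continuous (fun t : R => t ^+ n * f t).
Proof. by move=> fc x; apply: cvgM; [exact: exprn_continuous|exact: fc]. Qed.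

Lemma flux0 (R : realType) (n : nat) (f : R -> R) :
  continuous f -> flux n f 0 = 0.
Proof. by move=> fc; case: (primitiveP (@weight_continuous R n f fc)). Qed.

Lemma is_derive_flux (R : realType) (n : nat) (f : R -> R) (x : R) :
  continuous f -> is_derive x 1 (flux n f) (x ^+ n * f x).
Proof. by move=> fc; case: (primitiveP (@weight_continuous R n f fc)). Qed.

(* r^-(n+1) int_0^r t^n f(t) dt for r > 0, extended evenly and by its limit at
   0; the index [n] stands for dimension n+1. *)
Definition ravg (R : realType) (n : nat) (f : R -> R) (r : R) : R :=
  if r == 0 then f 0 / n.+1%:R else flux n f `|r| / `|r| ^+ n.+1.

Lemma ravgE (R : realType) (n : nat) (f : R -> R) (r : R) :
  continuous f -> 0 <= r -> r ^+ n.+1 * ravg n f r = flux n f r.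
Proof.
move=> fc r0; rewrite /ravg; case: eqVneq => [->|rn0].
  by rewrite flux0 // exprS !mul0r.
by rewrite ger0_norm // mulrCA divff ?mulr1 // expf_neq0.
Qed.

Lemma ravgN (R : realType) (n : nat) (f : R -> R) (r : R) :
  ravg n f (- r) = ravg n f r.
Proof. by rewrite /ravg oppr_eq0 normrN. Qed.

Lemma flux_le (R : realType) (n : nat) (f g : R -> R) (A r : R) :
  continuous f -> continuous g -> (forall t, 0 <= t <= A -> f t <= g t) ->
  0 <= r <= A -> flux n f r <= flux n g r.
Proof.
move=> fc gc fg /andP[r0 rA].
have D (x : R) : is_derive x 1 (flux n g - flux n f) (x ^+ n * g x - x ^+ n * f x).
  by apply: is_deriveB; exact: is_derive_flux.
rewrite -subr_ge0; suff : (flux n g - flux n f) 0 <= (flux n g - flux n f) r.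
  by rewrite !fctE !flux0 // subr0.
apply: (@derive_nondecr _ _ _ 0 r r0 _ (fun x _ => D x)) => x x0r.
  exact: is_derive_continuous (D x).
rewrite subr_ge0 ler_wpM2l ?exprn_ge0 ?fg //; lra.
Qed.

Lemma ravg_le (R : realType) (n : nat) (f g : R -> R) (A r : R) :
  continuous f -> continuous g -> (forall t, 0 <= t <= A -> f t <= g t) ->
  `|r| <= A -> ravg n f r <= ravg n g r.
Proof.
move=> fc gc fg rA; rewrite /ravg; case: eqVneq => [r0|rn0].
  by rewrite ler_wpM2r ?invr_ge0 ?ler0n // fg // lexx /= -(normr0 R) -r0.
by rewrite ler_wpM2r ?invr_ge0 ?exprn_ge0 // (@flux_le _ _ _ _ A) // normr_ge0.
Qed.

Lemma ravgDc (R : realType) (n : nat) (f : R -> R) (c r : R) :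
  continuous f -> ravg n (fun t => f t + c) r = ravg n f r + c / n.+1%:R.
Proof.
move=> fc; have fcc : continuous (fun t : R => f t + c).
  by move=> x; apply: cvgD; [exact: fc|exact: cvg_cst].
rewrite /ravg; case: eqVneq => [_|rn0]; first by rewrite mulrDl.
suff -> : flux n (fun t => f t + c) `|r| = flux n f `|r| + `|r| ^+ n.+1 * (c / n.+1%:R).
  by rewrite mulrDl mulrAC divff ?mul1r // expf_neq0 ?normr_eq0.
have D (x : R) : is_derive x 1 (fun x : R => flux n f x + x ^+ n.+1 * (c / n.+1%:R))
    (x ^+ n * (f x + c)).
  have -> : x ^+ n * (f x + c) = x ^+ n * f x + c / n.+1%:R * (n.+1%:R * x ^+ n).
    by rewrite mulrA divfK ?pnatr_eq0 // mulrDr [c * _]mulrC.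
  apply: derive_add; first exact: is_derive_flux.
  under eq_fun do rewrite mulrC.
  exact/derive_scale/derive_pow.
have := @derive_same _ _ _ _ 0 `|r| (normr_ge0 _)
  (fun x _ => is_derive_flux n x fcc) (fun x _ => D x).
by rewrite !flux0 // expr0n mul0r addr0 !subr0.
Qed.

Lemma ravg_cst (R : realType) (n : nat) (c r : R) :
  ravg n (fun=> c) r = c / n.+1%:R.
Proof.
have z : continuous ((fun=> 0) : R -> R) by exact: cst_continuous.
have -> : (fun=> c) = (fun t : R => (fun=> 0) t + c) by apply/funext => t; rewrite add0r.
rewrite ravgDc // [ravg _ _ _](_ : _ = 0) ?add0r //.
rewrite /ravg; case: eqVneq => [_|rn0]; first by rewrite mul0r.
suff -> : flux n (fun=> 0 : R) `|r| = 0 by rewrite mul0r.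
have D (x : R) : is_derive x 1 (fun=> 0 : R) (x ^+ n * 0) by rewrite mulr0; apply: is_derive_cst.
have := @derive_same _ _ _ _ 0 `|r| (normr_ge0 _)
  (fun x _ => is_derive_flux n x z) (fun x _ => D x).
by rewrite !flux0 // !subr0.
Qed.

Lemma ravg_dist (R : realType) (n : nat) (f g : R -> R) (A e r : R) :
  continuous f -> continuous g -> 0 <= e ->
  (forall t, 0 <= t <= A -> `|f t - g t| <= e) ->
  `|r| <= A -> `|ravg n f r - ravg n g r| <= e.
Proof.
move=> fc gc e0 fg rA.
have le1 (u v : R -> R) : continuous u -> continuous v ->
    (forall t, 0 <= t <= A -> u t <= v t + e) -> ravg n u r <= ravg n v r + e.
  move=> uc vc uv; apply: (@le_trans _ _ (ravg n (fun t => v t + e) r)).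
    apply: (@ravg_le _ _ _ _ A) => // x; apply: cvgD; [exact: vc|exact: cvg_cst].
  rewrite ravgDc // lerD2l ler_piMr // invf_le1 ?ltr0n // ler1n //.
have fg1 : ravg n f r <= ravg n g r + e.
  by apply: le1 => // t tA; have := fg t tA; rewrite ler_norml; lra.
have gf1 : ravg n g r <= ravg n f r + e.
  by apply: le1 => // t tA; have := fg t tA; rewrite ler_norml; lra.
by rewrite ler_norml; lra.
Qed.

Lemma ravg_continuous (R : realType) (n : nat) (f : R -> R) :
  continuous f -> continuous (ravg n f).
Proof.
move=> fc r; have [->|rn0] := eqVneq r 0.
  apply/cvgrPdist_le => e e0.
  have /cvgrPdist_le/(_ e e0)/nbhs_ballP[d /= d0 Hd] := fc 0.
  apply/nbhs_ballP; exists d => //= t; rewrite /ball /= sub0r normrN => td.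
  (* The value at 0 equals the average at [t] of the constant [f 0], so continuity at 0 becomes a
     comparison of two sources. *)
  rewrite {1}/ravg eqxx -(ravg_cst n (f 0) t).
  apply: (@ravg_dist _ _ _ _ `|t|) => //; first exact: cst_continuous.
    exact: ltW.
  move=> s /andP[s0 st]; apply: Hd; rewrite /ball /= sub0r normrN ger0_norm //.
  exact: le_lt_trans td.
have nr0 : `|r| ^+ n.+1 != 0 by rewrite expf_neq0 ?normr_eq0.
have C : (fun t => flux n f `|t| / `|t| ^+ n.+1) @ r --> flux n f `|r| / `|r| ^+ n.+1.
  apply: cvgM.
    apply: continuous_comp; first exact: norm_continuous.
    exact: is_derive_continuous (is_derive_flux _ _ fc).
  apply: cvgV => //; apply: (@continuous_comp _ _ _ (@Num.norm _ R) (fun t => t ^+ n.+1)).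
    exact: norm_continuous.
  exact: exprn_continuous.
rewrite /continuous_at [ravg n f r](_ : _ = flux n f `|r| / `|r| ^+ n.+1); last first.
  by rewrite /ravg (negPf rn0).
apply: (cvg_trans _ C); apply: near_eq_cvg.
have N : \forall t \near r, t != 0.
  by apply: open_nbhs_nbhs; split=> //; exact: open_neq.
near=> t; rewrite /ravg ifF //; apply/negbTE.
by near: t; exact: N.
Unshelve. all: by end_near.
Qed.

Lemma is_derive_ravg (R : realType) (n : nat) (f : R -> R) (r : R) :
  continuous f -> 0 < r ->
  is_derive r 1 (ravg n f) ((f r - n.+1%:R * ravg n f r) / r).
Proof.
move=> fc r0; have rn0 := lt0r_neq0 r0.
have D : is_derive r 1 (fun t => flux n f t * (t ^+ n.+1)^-1)
    ((f r - n.+1%:R * ravg n f r) / r).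
  have Dp := @derive_pow R n r.
  have nr0 : r ^+ n.+1 != 0 by rewrite expf_neq0.
  have Dv : is_derive r 1 (fun t : R => (t ^+ n.+1)^-1)
      (- (r ^+ n.+1) ^- 2 * (n.+1%:R * r ^+ n)).
    exact: (@is_deriveV R (fun t : R => t ^+ n.+1) r _ 1 nr0 Dp).
  apply: is_derive_eq (derive_mul (is_derive_flux n r fc) Dv) _.
  rewrite -ravgE ?ltW // exprS; field.
  by rewrite rn0 expf_neq0.
apply: near_eq_is_derive D; near=> t.
have t0 : 0 < t by near: t; apply: lt_nbhsr.
by rewrite -ravgE ?ltW // mulrC mulKf // expf_neq0 // lt0r_neq0.
Unshelve. all: by end_near.
Qed.

Lemma ravg_ge0 (R : realType) (n : nat) (f : R -> R) (r : R) :
  continuous f -> (forall t, 0 <= t <= `|r| -> 0 <= f t) -> 0 <= ravg n f r.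
Proof.
move=> fc f0; have -> : 0 = ravg n (fun=> 0) r by rewrite ravg_cst mul0r.
by apply: (@ravg_le _ _ _ _ `|r|) => //; exact: cst_continuous.
Qed.

Lemma ravg_ub (R : realType) (n : nat) (f : R -> R) (M r : R) :
  continuous f -> 0 <= M -> (forall t, 0 <= t <= `|r| -> f t <= M) ->
  ravg n f r <= M.
Proof.
move=> fc M0 fM; apply: (@le_trans _ _ (ravg n (fun=> M) r)).
  by apply: (@ravg_le _ _ _ _ `|r|) => //; exact: cst_continuous.
by rewrite ravg_cst ler_piMr // invf_le1 ?ltr0n // ler1n.
Qed.

Lemma ravg_gt0 (R : realType) (n : nat) (f : R -> R) (r : R) :
  continuous f -> (forall t, 0 <= t <= `|r| -> 0 <= f t) -> 0 < f 0 ->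
  0 < ravg n f r.
Proof.
move=> fc f_ge0 f0.
have [r0|rn0] := eqVneq r 0.
  by rewrite /ravg r0 eqxx divr_gt0 // ltr0n.
rewrite /ravg (negPf rn0) divr_gt0 // ?exprn_gt0 ?normr_gt0 //.
have ar0 : 0 < `|r| by rewrite normr_gt0.
have [d /= d0 Hd] : exists2 d, 0 < d & forall t, `|t| < d -> 0 < f t.
  have /cvgrPdist_lt/(_ (f 0) f0)/nbhs_ballP[d /= d0 Hd] := fc 0.
  exists d => // t td; have : `|f 0 - f t| < f 0.
    by apply: Hd; rewrite /ball /= sub0r normrN.
  by rewrite ltr_norml; lra.
pose a := Num.min `|r| (d / 2).
have a0 : 0 < a by rewrite lt_min ar0 divr_gt0.
have ar : a <= `|r| by rewrite ge_min lexx.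
have ad : a < d by rewrite gt_min; apply/orP; right; lra.
have D t := is_derive_flux n t fc.
have Dc t : {for t, continuous (flux n f)} by exact: is_derive_continuous (D t).
rewrite -(flux0 n fc); apply: (@lt_le_trans _ _ (flux n f a)).
  apply: (@derive_incr _ _ _ 0 a a0 (fun x _ => Dc x) (fun x _ => D x)) => x xa.
  by rewrite mulr_gt0 ?exprn_gt0 ?Hd ?ger0_norm; lra.
apply: (@derive_nondecr _ _ _ a `|r| ar (fun x _ => Dc x) (fun x _ => D x)) => x xa.
by rewrite mulr_ge0 ?exprn_ge0 ?f_ge0; lra.
Qed.

(* The radial solution of Delta w = f, w(0) = 0, in dimension n+1. *)
Definition rsol (R : realType) (n : nat) (f : R -> R) : R -> R :=
  primitive (fun r => r * ravg n f r).

Lemma rsolP (R : realType) (n : nat) (f : R -> R) : continuous f ->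
  rsol n f 0 = 0 /\ forall x : R, is_derive x 1 (rsol n f) (x * ravg n f x).
Proof.
move=> fc; apply: primitiveP => x.
by apply: cvgM; [exact: cvg_id|exact: ravg_continuous].
Qed.

Lemma rsol0 (R : realType) (n : nat) (f : R -> R) :
  continuous f -> rsol n f 0 = 0.
Proof. by move=> fc; case: (rsolP n fc). Qed.

Lemma is_derive_rsol (R : realType) (n : nat) (f : R -> R) (x : R) :
  continuous f -> is_derive x 1 (rsol n f) (x * ravg n f x).
Proof. by move=> fc; case: (rsolP n fc). Qed.

Lemma rsol_continuous (R : realType) (n : nat) (f : R -> R) :
  continuous f -> continuous (rsol n f).
Proof. move=> fc x; exact: is_derive_continuous (is_derive_rsol n x fc). Qed.

Lemma derive_comp_opp (R : realType) (f : R -> R) (x a : R) :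
  is_derive (- x) 1 f a -> is_derive x 1 (fun t => f (- t)) (- a).
Proof.
move=> fd; have Nx : is_derive x 1 (fun y : R => - y) (-1) by apply: is_deriveN.
by have := is_derive1_comp fd Nx; rewrite mulrN1.
Qed.

Lemma rsolN (R : realType) (n : nat) (f : R -> R) (r : R) :
  continuous f -> rsol n f (- r) = rsol n f r.
Proof.
move=> fc.
have D (x : R) : is_derive x 1 (fun t => rsol n f (- t)) (x * ravg n f x).
  rewrite -[_ * _]opprK -ravgN -mulNr.
  exact/derive_comp_opp/is_derive_rsol.
have pos (t : R) : 0 <= t -> rsol n f (- t) = rsol n f t.
  move=> t0; have := @derive_same _ _ _ _ 0 t t0
    (fun x _ => D x) (fun x _ => is_derive_rsol n x fc).
  by rewrite oppr0 rsol0 // !subr0.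
have [r0|r0] := leP 0 r; first exact: pos.
have := pos (- r); rewrite opprK oppr_ge0 => -> //; exact: ltW.
Qed.

Lemma rsol_norm (R : realType) (n : nat) (f : R -> R) (r : R) :
  continuous f -> rsol n f `|r| = rsol n f r.
Proof.
by move=> fc; have [r0|r0] := ger0P r; rewrite // rsolN.
Qed.

Lemma rsol_dist (R : realType) (n : nat) (f g : R -> R) (A e r : R) :
  continuous f -> continuous g -> 0 <= e ->
  (forall t, 0 <= t <= A -> `|f t - g t| <= e) ->
  `|r| <= A -> `|rsol n f r - rsol n g r| <= A * A * e.
Proof.
move=> fc gc e0 fg rA; rewrite -rsol_norm // -[rsol n g r]rsol_norm //.
move: (normr_ge0 r) rA; move: `|r| => {}r r0 rA.
have le1 (u v : R -> R) : continuous u -> continuous v ->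
    (forall t, 0 <= t <= A -> `|u t - v t| <= e) -> rsol n u r - rsol n v r <= A * A * e.
  move=> uc vc uv.
  have D (x : R) : is_derive x 1 (fun t => A * e * t - (rsol n u t - rsol n v t))
      (A * e * 1 - (x * ravg n u x - x * ravg n v x)).
    apply: derive_sub (derive_scale (A * e) (is_derive_id x 1)) _.
    exact: derive_sub (is_derive_rsol n x uc) (is_derive_rsol n x vc).
  have : A * e * 0 - (rsol n u 0 - rsol n v 0) <= A * e * r - (rsol n u r - rsol n v r).
    apply: (@derive_nondecr _ _ _ 0 r r0 _ (fun x _ => D x)) => x xr.
      exact: is_derive_continuous (D x).
    have : `|ravg n u x - ravg n v x| <= e.
      by apply: (@ravg_dist R n u v A); rewrite // ger0_norm; lra.
    by rewrite ler_norml => /andP[h1 h2]; nra.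
  rewrite !rsol0 // !subr0 mulr0 subr_ge0 => /le_trans; apply.
  by rewrite [A * e * r]mulrAC ler_wpM2r // ler_wpM2l //; lra.
have fg1 := le1 _ _ fc gc fg.
have gf1 : rsol n g r - rsol n f r <= A * A * e.
  by apply: le1 => // t tA; rewrite distrC; exact: fg.
by rewrite ler_norml; lra.
Qed.

Lemma rsol_bound (R : realType) (n : nat) (f : R -> R) (A M r : R) :
  continuous f -> (forall t, 0 <= t <= A -> 0 <= f t <= M) -> `|r| <= A ->
  `|rsol n f r| <= A * A * M.
Proof.
move=> fc fM rA; have A0 : 0 <= A by apply: le_trans rA.
have z : rsol n (fun=> 0) r = 0.
  have := @derive_same R (rsol n (fun=> 0)) (fun=> 0) (fun=> 0) 0 `|r| (normr_ge0 r).
  have c0 : continuous ((fun=> 0) : R -> R) by exact: cst_continuous.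
  rewrite rsol_norm // rsol0 // !subr0; apply => x _.
  by apply: is_derive_eq (is_derive_rsol n x c0) _; rewrite ravg_cst mul0r mulr0.
rewrite -[rsol n f r]subr0 -z; apply: rsol_dist => //; first exact: cst_continuous.
  by have := fM 0; lra.
by move=> t tA; rewrite subr0 ger0_norm; have := fM t tA; lra.
Qed.

(** The derivative r times average is at most [A * M]. The constant depends on [f] only through its
    bound, which later gives equicontinuity of the shots. *)
Lemma rsol_lipschitz (R : realType) (n : nat) (f : R -> R) (A M r s : R) :
  continuous f -> 0 <= M -> (forall t, 0 <= t <= A -> 0 <= f t <= M) ->
  `|r| <= A -> `|s| <= A -> `|rsol n f r - rsol n f s| <= A * M * `|r - s|.
Proof.
move=> fc M0 fM.
wlog rs : r s / s <= r.
  move=> H rA sA; have [sr|/ltW sr] := leP s r; first exact: H.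
  by rewrite distrC [`|r - s|]distrC; exact: H.
rewrite !ler_norml => rA sA; rewrite [`|r - s|]ger0_norm ?subr_ge0 //.
have bnd x : s <= x <= r -> `|x * ravg n f x| <= A * M.
  move=> xsr; have xA : `|x| <= A by rewrite ler_norml; lra.
  have rg0 : 0 <= ravg n f x.
    by apply: ravg_ge0 => // t tx; have := fM t; lra.
  rewrite normrM ler_pM // ger0_norm // ravg_ub // => t tx; have := fM t; lra.
have D (c x : R) : is_derive x 1 (fun t => A * M * t + c * rsol n f t)
    (A * M * 1 + c * (x * ravg n f x)).
  exact: derive_add (derive_scale (A * M) (is_derive_id x 1))
                    (derive_scale c (is_derive_rsol n x fc)).
have H c : `|c| = 1 -> A * M * s + c * rsol n f s <= A * M * r + c * rsol n f r.
  move=> c1; apply: (@derive_nondecr _ _ _ s r rs _ (fun x _ => D c x)) => x xsr.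
    exact: is_derive_continuous (D c x).
  have : `|c * (x * ravg n f x)| <= A * M by rewrite normrM c1 mul1r bnd; lra.
  by rewrite ler_norml; lra.
have := H 1 (normr1 _); have := H (-1) (normrN1 _).
by move=> h1 h2; lra.
Qed.

(** * Limits along ultrafilters *)

Lemma ultra_bounded_cvg (R : realType) (U : set_system nat) (a : nat -> R) (lo hi : R) :
  UltraFilter U -> (\forall m \near U, lo <= a m <= hi) ->
  exists2 l : R, lo <= l <= hi & a @ U --> l.
Proof.
move=> UU aU.
have [l []] := @segment_compact R lo hi (a @ U) _ aU.
rewrite /= in_itv /= => lb cl; exists l => // B Bl.
have [//|nB] := in_ultra_setVsetC (a @^-1` B) UU.
by have [x [nBx /nBx]] := cl (~` B) B nB Bl.
Qed.

(* Unlike locally uniform convergence, continuous convergence passes to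
   compositions without any compactness argument. *)
Definition cont_cvg (R : realType) (U : set_system nat) (f : nat -> R -> R)
    (g : R -> R) :=
  forall t e, 0 < e -> exists2 d, 0 < d &
    \forall m \near U, forall s, `|s - t| < d -> `|f m s - g t| <= e.

Lemma cont_cvg_uniform (R : realType) (U : set_system nat) (f : nat -> R -> R)
    (g : R -> R) : Filter U -> cont_cvg U f g -> continuous g ->
  forall A e, 0 < e -> \forall m \near U, forall s, `|s| <= A -> `|f m s - g s| <= e.
Proof.
move=> FU fg gc A e e0.
have /compact_near_coveringP/(_ nat U (fun m s => `|f m s - g s| <= e) FU) :=
  @segment_compact R (- A) A.
move=> H; have /H {}H : forall x, `[- A, A]%classic x ->
    \forall x' \near x & i \near U, `|f i x' - g x'| <= e.
  move=> x _; have e2 : 0 < e / 2 by lra.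
  have [d d0 Hd] := fg x _ e2.
  have /cvgrPdist_le/(_ _ e2) gx := gc x.
  exists ([set y | `|y - x| < d] `&` [set y | `|g x - g y| <= e / 2],
          [set m | forall s, `|s - x| < d -> `|f m s - g x| <= e / 2]).
    split=> //=; apply: filterI => //.
    apply/nbhs_ballP; exists d => //= y; rewrite /ball /= distrC //.
  move=> [y m] [/= [yd gy] Hm].
  have := Hm y yd; move: gy; rewrite !ler_norml; lra.
apply: filterS H => m Hm s sA; apply: Hm => /=; rewrite in_itv /=.
by rewrite -ler_norml.
Qed.

Lemma cont_cvg_cvg (R : realType) (U : set_system nat) (f : nat -> R -> R)
    (g : R -> R) (t : R) : Filter U -> cont_cvg U f g -> f m t @[m --> U] --> g t.
Proof.
move=> FU fg; apply/cvgrPdist_le => e e0; have [d d0 Hd] := fg t e e0.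
by apply: filterS Hd => m Hm; rewrite distrC Hm // subrr normr0.
Qed.

Lemma cont_cvg_point (R : realType) (U : set_system nat) (f : nat -> R -> R)
    (g : R -> R) (a : nat -> R) (t : R) : Filter U -> cont_cvg U f g ->
  a @ U --> t -> f m (a m) @[m --> U] --> g t.
Proof.
move=> FU fg /cvgrPdist_lt at_; apply/cvgrPdist_le => e e0.
have [d d0 Hd] := fg t e e0.
by apply: filterS2 Hd (at_ d d0) => m Hm ad; rewrite distrC Hm // distrC.
Qed.

(** For [s] near [t] the values [f m s] are eventually close to [g t], and they tend to [g s]. *)
Lemma cont_cvg_continuous (R : realType) (U : set_system nat) (f : nat -> R -> R)
    (g : R -> R) : ProperFilter U -> cont_cvg U f g -> continuous g.
Proof.
move=> FU fg t; apply/cvgrPdist_le => e e0.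
have e2 : 0 < e / 2 by lra.
have [d d0 Hd] := fg t _ e2.
apply/nbhs_ballP; exists d => //= s; rewrite /ball /= => td.
have Us : f m s @[m --> U] --> g s by apply: cont_cvg_cvg.
move: Us => /cvgrPdist_le/(_ _ e2) Hs.
have [m [/(_ s) h1 h2]] := filter_ex (filterI Hd Hs).
rewrite distrC in td; move: h2 (h1 td); rewrite !ler_norml; lra.
Qed.

Lemma cont_cvg_comp (R : realType) (U : set_system nat) (f : nat -> R -> R)
    (g h : R -> R) : Filter U -> continuous h -> cont_cvg U f g ->
  cont_cvg U (fun m t => h (f m t)) (fun t => h (g t)).
Proof.
move=> FU hc fg t e e0.
have /cvgrPdist_le/(_ e e0)/nbhs_ballP[d' /= d'0 Hd'] := hc (g t).
have d2 : 0 < d' / 2 by lra.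
have [d d0 Hd] := fg t _ d2; exists d => //; apply: filterS Hd => m Hm s sd.
rewrite distrC; apply: Hd'; rewrite /ball /= distrC.
by apply: le_lt_trans (Hm s sd) _; lra.
Qed.

Lemma cont_cvg_arg (R : realType) (U : set_system nat) (f : nat -> R -> R)
    (g : R -> R) (dl : nat -> R -> R) (d : R -> R) :
  Filter U -> cont_cvg U f g -> cont_cvg U dl d ->
  cont_cvg U (fun m t => f m (dl m t)) (fun t => g (d t)).
Proof.
move=> FU fg dld t e e0; have [r r0 Hr] := fg (d t) e e0.
have r2 : 0 < r / 2 by lra.
have [r' r'0 Hr'] := dld t _ r2; exists r' => //.
apply: filterS2 Hr Hr' => m h1 h2 s sr; apply: h1.
by apply: le_lt_trans (h2 s sr) _; lra.
Qed.

Lemma cont_cvgD (R : realType) (U : set_system nat) (f1 f2 : nat -> R -> R)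
    (g1 g2 : R -> R) : Filter U -> cont_cvg U f1 g1 -> cont_cvg U f2 g2 ->
  cont_cvg U (fun m t => f1 m t + f2 m t) (fun t => g1 t + g2 t).
Proof.
move=> FU h1 h2 t e e0; have e2 : 0 < e / 2 by lra.
have [d1 d10 H1] := h1 t _ e2; have [d2 d20 H2] := h2 t _ e2.
exists (Num.min d1 d2); first by rewrite lt_min d10.
apply: filterS2 H1 H2 => m {}h1 {}h2 s; rewrite lt_min => /andP[s1 s2].
by have := h1 s s1; have := h2 s s2; rewrite !ler_norml; lra.
Qed.

Lemma cont_cvgN (R : realType) (U : set_system nat) (f : nat -> R -> R)
    (g : R -> R) : Filter U -> cont_cvg U f g ->
  cont_cvg U (fun m t => - f m t) (fun t => - g t).
Proof. by move=> FU; apply: cont_cvg_comp; exact: opp_continuous. Qed.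

Lemma cont_cvg_cst (R : realType) (U : set_system nat) (a : nat -> R) (l : R) :
  Filter U -> a @ U --> l -> cont_cvg U (fun m _ => a m) (fun=> l).
Proof.
move=> FU /cvgrPdist_le al t e e0; exists 1 => //.
by apply: filterS (al e e0) => m Hm s _; rewrite distrC.
Qed.

Lemma cont_cvg_eqcont (R : realType) (U : set_system nat) (f : R -> R) :
  Filter U -> continuous f -> cont_cvg U (fun=> f) f.
Proof.
move=> FU fc t e e0; have /cvgrPdist_le/(_ e e0)/nbhs_ballP[d /= d0 Hd] := fc t.
exists d => //; apply: nearW => m s sd; rewrite distrC; apply: Hd.
by rewrite /ball /= distrC.
Qed.

(** Integration sees the source on a whole interval, so the local notion is first upgraded to
    uniform convergence there. *)
Lemma cont_cvg_rsol (R : realType) (U : set_system nat) (n : nat)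
    (f : nat -> R -> R) (g : R -> R) :
  ProperFilter U -> (forall m, continuous (f m)) -> cont_cvg U f g ->
  cont_cvg U (fun m => rsol n (f m)) (rsol n g).
Proof.
move=> FU fc fg; have gc := cont_cvg_continuous FU fg.
have rc := @rsol_continuous R n g gc.
move=> t e e0; have e2 : 0 < e / 2 by lra.
have [d d0 Hd] : exists2 d, 0 < d & \forall m \near U, forall s,
    `|s - t| < d -> `|rsol n g s - rsol n g t| <= e / 2.
  exact: cont_cvg_eqcont.
pose A := `|t| + 1.
have A0 : 0 < A by rewrite /A; have := normr_ge0 t; lra.
have e' : 0 < e / 2 / (A * A) by rewrite !divr_gt0 ?mulr_gt0.
exists (Num.min d 1); first by rewrite lt_min d0 ltr01.
have Un : \forall m \near U, forall s, `|s| <= A -> `|f m s - g s| <= e / 2 / (A * A).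
  exact: cont_cvg_uniform.
apply: filterS2 Hd Un => m h1 h2 s; rewrite lt_min => /andP[sd s1].
have sA : `|s| <= A.
  have := ler_normD (s - t) t; rewrite subrK /A; lra.
have : `|rsol n (f m) s - rsol n g s| <= A * A * (e / 2 / (A * A)).
  apply: rsol_dist sA => //; first exact: ltW.
  by move=> x xA; apply: h2; rewrite ger0_norm; lra.
rewrite mulrCA divff ?mulr1; last by rewrite mulf_neq0 ?lt0r_neq0.
by have := h1 s sd; rewrite !ler_norml; lra.
Qed.

Lemma cont_cvg_lipschitz (R : realType) (U : set_system nat) (f : nat -> R -> R)
    (g : R -> R) : Filter U ->
  (forall t, f m t @[m --> U] --> g t) ->
  (forall A, exists2 L, 0 <= L & forall m r s, `|r| <= A -> `|s| <= A ->
     `|f m r - f m s| <= L * `|r - s|) ->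
  cont_cvg U f g.
Proof.
move=> FU fg lip t e e0; have [L L0 HL] := lip (`|t| + 1).
have e2 : 0 < e / 2 by lra.
have L1 : 0 < L + 1 by lra.
exists (Num.min 1 (e / 2 / (L + 1))); first by rewrite lt_min ltr01 divr_gt0.
have /cvgrPdist_le/(_ _ e2) := fg t; apply: filterS => m Hm s.
rewrite lt_min => /andP[s1 s2].
have sA : `|s| <= `|t| + 1 by have := ler_normD (s - t) t; rewrite subrK; lra.
have tA : `|t| <= `|t| + 1 by lra.
have := HL m s t sA tA => h1.
have h2 : L * `|s - t| <= e / 2.
  move: s2; rewrite ltr_pdivlMr // => s2.
  by have := normr_ge0 (s - t); nra.
have := le_trans h1 h2; move: Hm; rewrite !ler_norml; lra.
Qed.

(** * Shooting *)

Lemma cvg_le (R : realType) (U : set_system nat) (a b : nat -> R) (x y : R) :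
  ProperFilter U -> a @ U --> x -> b @ U --> y ->
  (\forall m \near U, a m <= b m) -> x <= y.
Proof.
move=> FU /cvgrPdist_lt ax /cvgrPdist_lt bY ab; rewrite leNgt; apply/negP => yx.
have e0 : 0 < (x - y) / 2 by lra.
have [m [[h1 h2] h3]] := filter_ex (filterI (filterI (ax _ e0) (bY _ e0)) ab).
by move: h1 h2; rewrite !ltr_norml; lra.
Qed.

Lemma cvg_near_eq (R : realType) (U : set_system nat) (a b : nat -> R) (x y : R) :
  ProperFilter U -> a @ U --> x -> b @ U --> y ->
  (\forall m \near U, a m = b m) -> x = y.
Proof.
move=> FU ax bY ab; apply/eqP; rewrite eq_le (cvg_le FU ax bY) ?(cvg_le FU bY ax) //.
  by apply: filterS ab => m ->.
by apply: filterS ab => m ->.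
Qed.

Lemma ultra_or (U : set_system nat) (P Q : nat -> Prop) :
  UltraFilter U -> (\forall m \near U, P m \/ Q m) ->
  (\forall m \near U, P m) \/ (\forall m \near U, Q m).
Proof.
move=> UU PQ; have [?|nP] := in_ultra_setVsetC [set m | P m] UU; first by left.
by right; apply: filterS2 PQ nP => m /= [].
Qed.

Definition simplex (R : realType) (d : nat) (a : 'I_d -> R) :=
  (forall i, 0 <= a i) /\ \sum_i a i = 1.

(** All conditions are closed, so they pass to limits in [w] and [T]. The alternative [T = rho]
    covers the case that nothing vanishes before [rho]; then [i] is a lowest component at [rho]. *)
Definition first_hit (R : realType) (d : nat) (rho : R) (w : 'I_d -> R -> R)
    (i : 'I_d) (T : R) :=
  [/\ 0 <= T <= rho, forall l, w i T <= w l T, 0 <= w i T & w i T = 0 \/ T = rho].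

Lemma ex_first_hit (R : realType) (d : nat) (rho : R) (w : 'I_d.+1 -> R -> R) :
  0 <= rho -> (forall i, continuous (w i)) -> (forall i, 0 <= w i 0) ->
  (forall i r s, 0 <= r <= s -> s <= rho -> w i s <= w i r) ->
  exists i T, first_hit rho w i T.
Proof.
move=> rho0 wc w0 wdec.
have [/forallP allge|] := boolP [forall i, 0 <= w i rho].
  have [i _ imin] := @arg_minP _ _ _ ord0 xpredT (w ^~ rho) isT.
  by exists i, rho; split=> //; [lra|move=> l; exact: imin|right].
move=> /forallPn[i0]; rewrite -ltNge => i0lt.
have : forall i, exists c, w i rho < 0 -> 0 <= c <= rho /\ w i c = 0.
  move=> i; have [wi|wi] := ltP (w i rho) 0; last by exists 0; lra.
  have [||c] := @IVT R (w i) 0 rho 0 rho0.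
  - by apply: continuous_subspaceT => x; exact: wc.
  - by rewrite ge_min le_max w0 (ltW wi) orbT.
  by rewrite in_itv /= => c0 wc0; exists c.
(* The component with the earliest zero is taken; the others do not increase, so they are still
   nonnegative there. *)
move=> /(@boolp.choice _ _ _)[t Ht]; have [i iP imin] := @arg_minP _ _ _ i0 (fun i => w i rho < 0) t i0lt.
have [ti wti] := Ht i iP; exists i, (t i); split=> //; [|by rewrite wti|by left].
move=> l; rewrite wti; have [wl|wl] := ltP (w l rho) 0.
  by have [tl <-] := Ht l wl; apply: wdec; [rewrite (imin l wl); lra|lra].
by apply: le_trans wl (wdec _ _ _ _ _); lra.
Qed.

(** If one radius were smaller, the component vanishing there would be negative at the larger one,
    where even the lowest component is nonnegative. *)
Lemma first_hit_unique (R : realType) (d : nat) (rho : R) (w : 'I_d -> R -> R) i j T S :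
  (forall i r s, 0 <= r < s -> s <= rho -> w i s < w i r) ->
  first_hit rho w i T -> first_hit rho w j S -> T = S.
Proof.
move=> wdec.
have H i' j' T' S' : first_hit rho w i' T' -> first_hit rho w j' S' -> S' <= T'.
  move=> [T1 T2 T3 T4] [S1 S2 S3 S4]; rewrite leNgt; apply/negP => TS.
  case: T4 => T4; last lra.
  have : w i' S' < w i' T' by apply: wdec; lra.
  by have := S2 i'; lra.
by move=> h1 h2; apply/eqP; rewrite eq_le (H _ _ _ _ h1 h2) (H _ _ _ _ h2 h1).
Qed.

(** Points of the grid of mesh 1/(N+1) are coloured by a component that hits first; the spread
    [d.+1] of the combinatorial lemma is rescaled by the mesh. *)
Lemma approx_shooting (R : realType) (d : nat) (rho : R)
    (W : ('I_d.+1 -> R) -> 'I_d.+1 -> R -> R) (N : nat) :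
  (forall a, simplex a -> exists i T, first_hit rho (W a) i T) ->
  exists CaT : {set 'I_d.+1} * ('I_d.+1 -> 'I_d.+1 -> R) * ('I_d.+1 -> R),
    let: (C, a, T) := CaT in
    [/\ C != finset.set0,
     forall i, i \in C -> simplex (a i) /\ first_hit rho (W (a i)) i (T i),
     forall i j l, i \in C -> j \in C -> a i l <= a j l + d.+1%:R / N.+1%:R &
     forall i l, i \in C -> l \notin C -> a i l <= d.+1%:R / N.+1%:R].
Proof.
move=> hit; pose G := {x : {ffun 'I_d.+1 -> 'I_N.+2} | \sum_j val (x j) == N.+1}.
pose al (x : G) (i : 'I_d.+1) : R := (val (val x i))%:R / N.+1%:R.
have N0 : (N.+1%:R : R) != 0 by rewrite pnatr_eq0.
have als x : simplex (al x).
  split=> [i|]; first by rewrite divr_ge0.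
  by rewrite -mulr_suml -natr_sum (eqP (valP x)) divff.
have [cT HcT] := boolp.choice (fun x : G => let: ex_intro i (ex_intro T H) := hit _ (als x) in
  ex_intro (fun p : 'I_d.+1 * R => first_hit rho (W (al x)) p.1 p.2) (i, T) H).
have [C [y [C0 Cy yy yC]]] := @grid_colouring d N.+1 (fun x => (cT x).1).
exists (C, fun i => al (y i), fun i => (cT (y i)).2); split=> //.
- by move=> i iC; split=> //; have := HcT (y i); rewrite Cy.
- move=> i j l iC jC; rewrite /al -mulrDl -natrD ler_wpM2r ?invr_ge0 //.
  by rewrite ler_nat; exact: yy.
- move=> i l iC lC; rewrite /al ler_wpM2r ?invr_ge0 // ler_nat; exact: yC.
Qed.

Lemma near_inv_le (R : realType) (U : set_system nat) (c e : R) :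
  Filter U -> \oo `<=` U -> 0 < e -> \forall m \near U, c / m.+1%:R <= e.
Proof.
move=> FU oU e0; apply: oU.
have := @cvg_harmonic R => /cvgrPdist_le /(_ (e / (`|c| + 1))).
have c1 : 0 < `|c| + 1 by have := normr_ge0 c; lra.
move=> /(_ (divr_gt0 e0 c1)); apply: filterS => m /=.
rewrite sub0r normrN ger0_norm ?invr_ge0 // ler_pdivlMr //.
rewrite mulrC => h; apply: le_trans h; rewrite ler_wpM2r ?invr_ge0 //.
by have := ler_norm c; lra.
Qed.

(** As the mesh tends to 0 the selected grid points merge into one point, at which every component
    is a first one to hit. The hitting radii agree by uniqueness, and the values there agree because
    each is a lowest one. *)
Lemma shooting (R : realType) (d : nat) (rho : R)
    (W : ('I_d.+1 -> R) -> 'I_d.+1 -> R -> R) :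
  0 < rho -> (forall a i, W a i 0 = a i) -> (forall a i, continuous (W a i)) ->
  (forall a i r s, 0 <= r < s -> s <= rho -> W a i s < W a i r) ->
  (forall (U : set_system nat) (a : nat -> 'I_d.+1 -> R) (b : 'I_d.+1 -> R),
     UltraFilter U -> (forall i, a m i @[m --> U] --> b i) ->
     forall i, cont_cvg U (fun m => W (a m) i) (W b i)) ->
  exists a T c, [/\ simplex a, 0 <= T <= rho, 0 <= c, forall i, W a i T = c &
    c = 0 \/ T = rho].
Proof.
move=> rho0 W0 Wc Wdec Wcvg.
have Wdec' a i r s : 0 <= r <= s -> s <= rho -> W a i s <= W a i r.
  move=> /andP[r0]; rewrite le_eqVlt => /orP[/eqP -> //|rs] sr.
  by apply/ltW/Wdec; lra.
have hit a : simplex a -> exists i T, first_hit rho (W a) i T.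
  move=> [a0 _]; apply: ex_first_hit => //; first exact: ltW.
    by move=> i; rewrite W0.
  exact: Wdec'.
have aS N := @approx_shooting R d rho W N hit.
have [F HF] := boolp.choice aS.
pose C m := (F m).1.1; pose a m := (F m).1.2; pose T m := (F m).2.
have {}HF m : [/\ C m != finset.set0,
     forall i, i \in C m -> simplex (a m i) /\ first_hit rho (W (a m i)) i (T m i),
     forall i j l, i \in C m -> j \in C m -> a m i l <= a m j l + d.+1%:R / m.+1%:R &
     forall i l, i \in C m -> l \notin C m -> a m i l <= d.+1%:R / m.+1%:R].
  by have := HF m; rewrite /C /a /T; case: (F m) => [[]].
have [U [UU oU]] := @ultraFilterLemma _ _ eventually_filter.
have UF := @ultra_proper _ _ UU.
have Ucst (x : R) : (fun=> x) @ U --> x by exact: cvg_cst.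
have [b Hb] : exists b, forall m, b m \in C m.
  have ex m : exists i, i \in C m by have [/set0Pn] := HF m.
  by have [b Hb] := boolp.choice ex; exists b.
have : forall l, exists x : R, 0 <= x /\ a m (b m) l @[m --> U] --> x.
  move=> l; have [|x /andP[x0 _] xU] := @ultra_bounded_cvg R U (fun m => a m (b m) l) 0 1.
    apply: nearW => m.
    have [_ /(_ _ (Hb m))[[a0 a1] _] _ _] := HF m.
    rewrite a0 /= -a1 (bigD1 l) //= lerDl sumr_ge0 //.
  by exists x.
move=> /(@boolp.choice _ _ _)[al Hal].
have als : simplex al.
  split=> [i|]; first by case: (Hal i).
  have S : (fun m => \sum_l a m (b m) l) @ U --> \sum_l al l.
    by apply: cvg_big => [|l _]; [exact: add_continuous|case: (Hal l)].
  apply: (cvg_near_eq UF S (Ucst 1)); apply: nearW => m.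
  by have [_ /(_ _ (Hb m))[[]]] := HF m.
have close (e : R) : 0 < e -> \forall m \near U, d.+1%:R / m.+1%:R <= e.
  by move=> e0; exact: near_inv_le oU e0.
(* A component that is a colour for almost all [m] inherits its hit in the limit; any other has
   [al i = 0] and hits at radius 0. *)
have hits i : exists T, first_hit rho (W al) i T.
  have [iC|niC] := in_ultra_setVsetC [set m | i \in C m] UU; last first.
    have ali : al i <= 0.
      apply/ler_addgt0Pr => e e0; rewrite add0r.
      have [_ ai] := Hal i; apply: (cvg_le UF ai (Ucst e)).
      apply: filterS2 (close e e0) niC => m h1 /= /negP iC.
      by apply: le_trans h1; have [_ _ _ H] := HF m; exact: H.
    exists 0; split; [by rewrite lexx ltW| |by rewrite W0; case: als|].
      by move=> l; rewrite !W0; apply: le_trans ali _; case: als.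
    by left; rewrite W0; apply/eqP; rewrite eq_le ali; case: als => -> _.
  have ai l : a m i l @[m --> U] --> al l.
    apply/cvgrPdist_le => e e0; have e2 : 0 < e / 2 by lra.
    have [_ /cvgrPdist_le/(_ _ e2) h1] := Hal l.
    apply: filterS3 iC h1 (close _ e2) => m /= iCm h1 h2.
    have [_ _ H _] := HF m.
    have := H _ _ l iCm (Hb m); have := H _ _ l (Hb m) iCm.
    by move: h1 h2; move: (d.+1%:R / m.+1%:R) => D; rewrite !ler_norml; lra.
  have [|S S0 TS] := @ultra_bounded_cvg R U (fun m => T m i) 0 rho.
    apply: filterS iC => m /= iCm.
    by have [_ /(_ _ iCm)[_ []]] := HF m.
  have WS l : W (a m i) l (T m i) @[m --> U] --> W al l S.
    exact: (@cont_cvg_point R U (fun m => W (a m i) l) (W al l) (fun m => T m i) S _ (Wcvg _ (fun m => a m i) al UU ai l) TS).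
  have hm : \forall m \near U, first_hit rho (W (a m i)) i (T m i).
    by apply: filterS iC => m /= iCm; have [_ /(_ _ iCm)[]] := HF m.
  exists S; split=> //.
  - move=> l; apply: (cvg_le UF (WS i) (WS l)).
    by apply: filterS hm => m [].
  - apply: (cvg_le UF (Ucst 0) (WS i)).
    by apply: filterS hm => m [].
  - have : \forall m \near U, W (a m i) i (T m i) = 0 \/ T m i = rho.
      by apply: filterS hm => m [].
    case/(ultra_or UU) => h; [left|right].
      exact: (cvg_near_eq UF (WS i) (Ucst 0)).
    exact: (cvg_near_eq UF TS (Ucst rho)).
have [S0 HS0] := hits ord0.
have hitS i : first_hit rho (W al) i S0.
  have [S HS] := hits i.
  by rewrite -(@first_hit_unique _ _ _ _ i ord0 S S0 (Wdec al) HS HS0).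
exists al, S0, (W al ord0 S0); case: HS0 => h1 h2 h3 h4; split=> // i.
by case: (hitS i) => _ /(_ ord0) h _ _; apply/eqP; rewrite eq_le h h2.
Qed.

(** * The delayed system and its limit *)

(** The method of steps, as [N] Picard iterations from the constant [a]. The truncation at 0 feeds
    the initial value to the source for t below [eps]. *)
Fixpoint delayed (R : realType) (n d : nat) (nx : 'I_d -> 'I_d) (g : 'I_d -> R -> R)
    (eps : R) (a : 'I_d -> R) (N : nat) (i : 'I_d) : R -> R :=
  if N is N'.+1 then
    fun r => a i - rsol n (fun t =>
      g i (delayed n nx g eps a N' (nx i) (Num.max (t - eps) 0)) + eps) r
  else fun=> a i.

Definition delayed_source (R : realType) (n d : nat) (nx : 'I_d -> 'I_d)
    (g : 'I_d -> R -> R) (eps : R) (a : 'I_d -> R) (N : nat) (i : 'I_d) (t : R) : R :=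
  g i (delayed n nx g eps a N (nx i) (Num.max (t - eps) 0)) + eps.

Lemma continuous_compose (R : realType) (f g : R -> R) :
  continuous f -> continuous g -> continuous (fun t : R => g (f t)).
Proof. by move=> fc gc t; exact: continuous_comp (fc t) (gc (f t)). Qed.

Lemma delay_dist (R : realType) (eps s t : R) : 0 <= eps ->
  `|Num.max (s - eps) 0 - Num.max t 0| <= `|s - t| + eps.
Proof.
move=> e0; have := ler_norm (s - t); have := ler_norm (t - s).
rewrite [`|t - s|]distrC => h1 h2.
rewrite ler_norml; have [] := leP (s - eps) 0; have [] := leP t 0; lra.
Qed.

Lemma delay_continuous (R : realType) (eps : R) :
  continuous (fun t : R => Num.max (t - eps) 0).
Proof.
move=> t; apply/cvgrPdist_le => e e0; apply/nbhs_ballP; exists e => //= s.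
rewrite /ball /= => ts.
have := ler_norm (s - t); have := ler_norm (t - s); rewrite [`|s - t|]distrC.
rewrite ler_norml; have [] := leP (s - eps) 0; have [] := leP (t - eps) 0; lra.
Qed.

Lemma delayed_source_continuous (R : realType) (n d : nat) (nx : 'I_d -> 'I_d)
    (g : 'I_d -> R -> R) (eps : R) (a : 'I_d -> R) (N : nat) (i : 'I_d) :
  (forall i, continuous (g i)) -> continuous (delayed_source n nx g eps a N i).
Proof.
move=> gc.
have step M j : (forall j, continuous (delayed n nx g eps a M j)) ->
    continuous (delayed_source n nx g eps a M j).
  move=> dc t; apply: cvgD; last exact: cvg_cst.
  have cc := continuous_compose (@delay_continuous R eps) (dc (nx j)).
  exact: (continuous_compose cc (gc j)).
elim: N i => [|N IH] i; apply: step => j.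
  exact: cst_continuous.
move=> t; apply: cvgB; first exact: cvg_cst.
exact: (@rsol_continuous R n _ (IH j)).
Qed.

Lemma delayed_continuous (R : realType) (n d : nat) (nx : 'I_d -> 'I_d)
    (g : 'I_d -> R -> R) (eps : R) (a : 'I_d -> R) (N : nat) (i : 'I_d) :
  (forall i, continuous (g i)) -> continuous (delayed n nx g eps a N i).
Proof.
move=> gc; case: N => [|N]; first exact: cst_continuous.
move=> t; apply: cvgB; first exact: cvg_cst.
exact: (@rsol_continuous R n _ (@delayed_source_continuous _ n _ nx g eps a N i gc)).
Qed.

Lemma delayed0 (R : realType) (n d : nat) (nx : 'I_d -> 'I_d)
    (g : 'I_d -> R -> R) (eps : R) (a : 'I_d -> R) (N : nat) (i : 'I_d) :
  (forall i, continuous (g i)) -> delayed n nx g eps a N i 0 = a i.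
Proof.
move=> gc; case: N => [//|N] /=.
by rewrite (@rsol0 _ n _ (@delayed_source_continuous _ n _ nx g eps a N i gc)) subr0.
Qed.

Lemma rsol_eq (R : realType) (n : nat) (f g : R -> R) (r : R) :
  continuous f -> continuous g -> (forall t, 0 <= t <= `|r| -> f t = g t) ->
  rsol n f r = rsol n g r.
Proof.
move=> fc gc fg; apply/eqP; rewrite -subr_eq0 -normr_le0.
have := @rsol_dist R n f g `|r| 0 r fc gc (lexx _) _ (lexx _).
by rewrite mulr0; apply => t tr; rewrite fg // subrr normr0.
Qed.

(** The source at t sees the previous iterate only up to t - [eps], so each iteration settles a
    further interval of length [eps]. *)
Lemma delayed_stable (R : realType) (n d : nat) (nx : 'I_d -> 'I_d)
    (g : 'I_d -> R -> R) (eps : R) (a : 'I_d -> R) (N : nat) (i : 'I_d) (r : R) :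
  (forall i, continuous (g i)) -> 0 <= eps -> 0 <= r <= N%:R * eps ->
  delayed n nx g eps a N i r = delayed n nx g eps a N.+1 i r.
Proof.
move=> gc e0; elim: N i r => [|N IH] i r.
  rewrite mul0r => r0; have -> : r = 0 by apply/eqP; rewrite eq_le andbC.
  by rewrite (delayed0 n nx eps a 0 i gc) (delayed0 n nx eps a 1 i gc).
move=> rN; rewrite -[LHS]/(a i - rsol n (delayed_source n nx g eps a N i) r).
rewrite -[RHS]/(a i - rsol n (delayed_source n nx g eps a N.+1 i) r); congr (_ - _).
apply: rsol_eq; try exact: delayed_source_continuous.
have r0 : 0 <= r by case/andP: rN.
move=> t; rewrite (ger0_norm r0) => tr.
congr (g i _ + _); apply: IH.
rewrite le_max lexx orbT /= ge_max; apply/andP; split; last by rewrite mulr_ge0.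
by move: rN; rewrite -natr1 mulrDl mul1r; lra.
Qed.

Lemma rsol_incr (R : realType) (n : nat) (f : R -> R) (r s : R) :
  continuous f -> (forall t, 0 <= t -> 0 <= f t) -> 0 < f 0 -> 0 <= r < s ->
  rsol n f r < rsol n f s.
Proof.
move=> fc f0 f00 /andP[r0 rs].
apply: (@derive_incr _ _ _ r s rs (fun x _ => @rsol_continuous R n f fc x)
  (fun x _ => is_derive_rsol n x fc)) => x xrs.
have x0 : 0 < x by lra.
by rewrite mulr_gt0 // ravg_gt0 // => t /andP[t0 _]; exact: f0.
Qed.

Lemma rsol_nondecr (R : realType) (n : nat) (f : R -> R) (r s : R) :
  continuous f -> (forall t, 0 <= t -> 0 <= f t) -> 0 <= r <= s ->
  rsol n f r <= rsol n f s.
Proof.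
move=> fc f0 /andP[r0 rs].
apply: (@derive_nondecr _ _ _ r s rs (fun x _ => @rsol_continuous R n f fc x)
  (fun x _ => is_derive_rsol n x fc)) => x xrs.
have x0 : 0 <= x by lra.
by rewrite mulr_ge0 // ravg_ge0 // => t /andP[t0 _]; exact: f0.
Qed.

Lemma rsol_ge0 (R : realType) (n : nat) (f : R -> R) (r : R) :
  continuous f -> (forall t, 0 <= t -> 0 <= f t) -> 0 <= rsol n f r.
Proof.
move=> fc f0; rewrite -(rsol_norm _ _ fc) -(rsol0 n fc).
by apply: rsol_nondecr; rewrite // lexx normr_ge0.
Qed.

(** The added [eps] keeps the source positive even where [g] vanishes; uniqueness of the hitting
    radius rests on this strictness. *)
Lemma delayed_decr (R : realType) (n d : nat) (nx : 'I_d -> 'I_d)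
    (g : 'I_d -> R -> R) (eps : R) (a : 'I_d -> R) (N : nat) (i : 'I_d) (r s : R) :
  (forall i, continuous (g i)) -> (forall i y, 0 <= g i y) -> 0 < eps ->
  0 <= r < s -> delayed n nx g eps a N.+1 i s < delayed n nx g eps a N.+1 i r.
Proof.
move=> gc g0 e0 rs /=; rewrite ltrD2l ltrN2.
have sp t : 0 < delayed_source n nx g eps a N i t by rewrite ltr_wpDl.
apply: rsol_incr rs; [exact: delayed_source_continuous| |exact: sp].
by move=> t _; exact: ltW (sp t).
Qed.

Lemma delayed_le (R : realType) (n d : nat) (nx : 'I_d -> 'I_d)
    (g : 'I_d -> R -> R) (eps : R) (a : 'I_d -> R) (N : nat) (i : 'I_d) (r : R) :
  (forall i, continuous (g i)) -> (forall i y, 0 <= g i y) -> 0 <= eps ->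
  delayed n nx g eps a N i r <= a i.
Proof.
move=> gc g0 e0; case: N => [//|N] /=; rewrite gerBl.
apply: rsol_ge0; first exact: delayed_source_continuous.
by move=> t _; rewrite addr_ge0.
Qed.

Lemma delayed_cvg (R : realType) (n d : nat) (nx : 'I_d -> 'I_d)
    (g : 'I_d -> R -> R) (eps : R) (U : set_system nat) (a : nat -> 'I_d -> R)
    (b : 'I_d -> R) (N : nat) (i : 'I_d) :
  (forall i, continuous (g i)) -> ProperFilter U ->
  (forall i, a m i @[m --> U] --> b i) ->
  cont_cvg U (fun m => delayed n nx g eps (a m) N i) (delayed n nx g eps b N i).
Proof.
move=> gc UF ab; elim: N i => [|N IH] i; first exact: (cont_cvg_cst _ (ab i)).
apply: (@cont_cvgD _ _ (fun m t => a m i) _ (fun=> b i)); first exact: (cont_cvg_cst _ (ab i)).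
apply: (@cont_cvgN _ _ _ _ _).
apply: (@cont_cvg_rsol _ _ _ (fun m => delayed_source n nx g eps (a m) N i)
   (delayed_source n nx g eps b N i)) => //.
  by move=> m; exact: delayed_source_continuous.
apply: (@cont_cvgD _ _ _ (fun _ _ => eps) _ (fun=> eps)); last first.
  by apply: cont_cvg_cst; exact: cvg_cst.
apply: (@cont_cvg_comp _ _ _ _ (g i)) => //.
exact: (@cont_cvg_arg R U (fun m => delayed n nx g eps (a m) N (nx i))
  (delayed n nx g eps b N (nx i)) (fun _ t => Num.max (t - eps) 0)
  (fun t => Num.max (t - eps) 0) _ (IH _)
  (@cont_cvg_eqcont R U _ _ (@delay_continuous R eps))).
Qed.

(* The delay and the extra source are both 1/(m+1), the radius is m+1, and [F i]
   is the source of the component [w i]. *)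
Definition shot (R : realType) (n d : nat) (nx : 'I_d -> 'I_d) (g : 'I_d -> R -> R)
    (m : nat) (a : 'I_d -> R) (w F : 'I_d -> R -> R) (T c : R) :=
  [/\ simplex a, [/\ 0 <= T <= m.+1%:R, 0 <= c, (forall i, w i T = c) &
        c = 0 \/ T = m.+1%:R],
      (forall i, w i 0 = a i) /\ (forall i r s, 0 <= r <= s -> w i s <= w i r),
      forall i, [/\ continuous (F i), (forall t, 0 <= F i t <= 2) &
        forall r, w i r = a i - rsol n (F i) r] &
      forall i t, t <= m.+1%:R ->
        F i t = g i (w (nx i) (Num.max (t - m.+1%:R^-1) 0)) + m.+1%:R^-1].

Lemma ex_shot (R : realType) (n d : nat) (nx : 'I_d.+1 -> 'I_d.+1)
    (g : 'I_d.+1 -> R -> R) (m : nat) :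
  (forall i, continuous (g i)) -> (forall i y, 0 <= g i y) ->
  (forall i y, y <= 1 -> g i y <= 1) ->
  exists a w F T c, shot n nx g m a w F T c.
Proof.
move=> gc g0 g1; pose eps : R := m.+1%:R^-1.
have e0 : 0 < eps by rewrite invr_gt0.
have e1 : eps <= 1 by rewrite invf_le1 ?ler1n.
(* This makes [N * eps] equal to m+1 - [eps], the largest delayed argument for t up to m+1; there
   the iterates [N] and [N.+1] still agree. *)
pose N := (m.+1 * m.+1).-1; have NE : N.+1 = (m.+1 * m.+1)%N by [].
pose W (a : 'I_d.+1 -> R) i := delayed n nx g eps a N.+1 i.
have rho0 : (0 : R) < m.+1%:R by [].
have [a [T [c [as_ T1 c0 WT cT]]]] := @shooting R d m.+1%:R W rho0
  (fun a i => delayed0 n nx eps a N.+1 i gc)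
  (fun a i => @delayed_continuous R n _ nx g eps a N.+1 i gc)
  (fun a i r s rs _ => delayed_decr n nx a N i gc g0 e0 rs)
  (fun U a b (UU : UltraFilter U) ab i => @delayed_cvg R n _ nx g eps U a b N.+1 i gc
     (@ultra_proper _ _ UU) ab).
have a1 i : a i <= 1 by case: as_ => a0 <-; rewrite (bigD1 i) //= lerDl sumr_ge0.
exists a, (W a), (delayed_source n nx g eps a N), T, c; split=> //.
- split=> [i|i r s]; first exact: (delayed0 n nx eps a N.+1 i gc).
  move=> /andP[r0]; rewrite le_eqVlt => /orP[/eqP -> //|rs].
  by apply/ltW; apply: delayed_decr => //; rewrite r0.
- move=> i; split=> //; first exact: delayed_source_continuous.
  move=> t; rewrite /delayed_source; apply/andP; split.
    by rewrite addr_ge0 // ltW.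
  have : g i (delayed n nx g eps a N (nx i) (Num.max (t - eps) 0)) <= 1.
    by apply: g1; apply: le_trans (a1 (nx i)); apply: delayed_le => //; exact: ltW.
  by lra.
- move=> i t tm; rewrite /delayed_source /W delayed_stable //; first exact: ltW.
  rewrite le_max lexx orbT /= ge_max; apply/andP; split; last first.
    by rewrite mulr_ge0 // ltW.
  have -> : N%:R * eps = m.+1%:R - eps.
    have -> : (N%:R : R) = m.+1%:R * m.+1%:R - 1 by rewrite -natrM -NE -natr1 addrK.
    by rewrite mulrBl mul1r -mulrA divff ?mulr1 // lt0r_neq0.
  by lra.
Qed.

Lemma cont_cvg_near (R : realType) (U : set_system nat) (f f' : nat -> R -> R)
    (g : R -> R) : Filter U ->
  (forall A, \forall m \near U, forall s, s <= A -> f m s = f' m s) ->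
  cont_cvg U f' g -> cont_cvg U f g.
Proof.
move=> FU ff' f'g t e e0; have [d d0 Hd] := f'g t e e0; exists d => //.
apply: filterS2 Hd (ff' (t + d)) => m h1 h2 s sd; rewrite h2; first exact: h1.
by have := ler_norm (s - t); lra.
Qed.

(** The sources are bounded by 2 for every [m], so the shots are equi-Lipschitz on bounded intervals
    and their pointwise limits along the ultrafilter are continuous limits. The delay and the extra
    source then drop out of the equation. *)
Lemma limit_of_shots (R : realType) (n d : nat) (nx : 'I_d.+1 -> 'I_d.+1)
    (g : 'I_d.+1 -> R -> R) :
  (forall i, continuous (g i)) -> (forall i y, 0 <= g i y) ->
  (forall i y, y <= 1 -> g i y <= 1) ->
  exists (a : 'I_d.+1 -> R) (v : 'I_d.+1 -> R -> R),
    [/\ simplex a, forall i, continuous (v i),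
      forall i r, v i r = a i - rsol n (fun t => g i (v (nx i) t)) r &
      (exists2 T, 0 < T & forall i, v i T = 0) \/ (forall i r, 0 <= r -> 0 <= v i r)].
Proof.
move=> gc g0 g1.
have ex m : exists z : ('I_d.+1 -> R) * ('I_d.+1 -> R -> R) *
    ('I_d.+1 -> R -> R) * (R * R),
    shot n nx g m z.1.1.1 z.1.1.2 z.1.2 z.2.1 z.2.2.
    have [a [w [F [T [c H]]]]] := @ex_shot R n d nx g m gc g0 g1.
    by exists (a, w, F, (T, c)).
have [Z HZ] := boolp.choice ex.
pose a m := (Z m).1.1.1; pose w m := (Z m).1.1.2; pose F m := (Z m).1.2.
pose T m := (Z m).2.1; pose c m := (Z m).2.2.
have {}HZ m : shot n nx g m (a m) (w m) (F m) (T m) (c m) by exact: HZ.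
move: (a) (w) (F) (T) (c) HZ => {Z}{}a {}w {}F {}T {}c HZ.
have [U [UU oU]] := @ultraFilterLemma _ _ eventually_filter.
have UF := @ultra_proper _ _ UU.
have Ucst (x : R) : (fun=> x) @ U --> x by exact: cvg_cst.
have epsU : (fun m => m.+1%:R^-1 : R) @ U --> (0 : R).
  by apply: cvg_trans (@cvg_harmonic R) => B /oU.
have largeU (A : R) : \forall m \near U, A < m.+1%:R.
  apply: oU; have := @nbhs_infty_gtr R A; apply: filterS => m /lt_le_trans; apply.
  by rewrite ler_nat.
have asx m i : 0 <= a m i <= 1.
  have [[a0 a1] _ _ _ _] := HZ m.
  by rewrite a0 -a1 (bigD1 i) //= lerDl sumr_ge0.
have wE m i r : w m i r = a m i - rsol n (F m i) r by have [_ _ _ /(_ i)[]] := HZ m.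
have Fc m i : continuous (F m i) by have [_ _ _ /(_ i)[]] := HZ m.
have F2 m i t : 0 <= F m i t <= 2 by have [_ _ _ /(_ i)[]] := HZ m.
have : forall i, exists x : R, 0 <= x /\ a m i @[m --> U] --> x.
  move=> i; have [|x /andP[x0 _] xU] := @ultra_bounded_cvg R U (fun m => a m i) 0 1.
    exact: nearW.
  by exists x.
move=> /(@boolp.choice _ _ _)[al Hal].
have als : simplex al.
  split=> [i|]; first by case: (Hal i).
  have S : (fun m => \sum_l a m l) @ U --> \sum_l al l.
    by apply: cvg_big => [|l _]; [exact: add_continuous|case: (Hal l)].
  by apply: (cvg_near_eq UF S (Ucst 1)); apply: nearW => m; have [[]] := HZ m.
have : forall i, exists vi : R -> R, forall r, w m i r @[m --> U] --> vi r.
  move=> i; have exv r : exists y : R, w m i r @[m --> U] --> y.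
    have [|x _ xU] := @ultra_bounded_cvg R U (fun m => w m i r) (- (`|r| * `|r| * 2)) (1 + `|r| * `|r| * 2).
      apply: nearW => m; rewrite wE.
      have := @rsol_bound R n (F m i) `|r| 2 r (Fc m i) (fun t _ => F2 m i t) (lexx _).
      by have := asx m i; rewrite ler_norml; lra.
    by exists x.
  by have [vi Hvi] := boolp.choice exv; exists vi.
move=> /(@boolp.choice _ _ _)[v Hv].
have wv i : cont_cvg U (fun m => w m i) (v i).
  apply: (@cont_cvg_lipschitz _ _ _ _ _ (Hv i)) => A.
  exists (Num.max 0 A * 2); first by rewrite mulr_ge0 // le_max lexx.
  move=> m r s rA sA; rewrite !wE.
  have -> : a m i - rsol n (F m i) r - (a m i - rsol n (F m i) s) =
    - (rsol n (F m i) r - rsol n (F m i) s) by ring.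
  rewrite normrN.
  have A0 : 0 <= A by apply: le_trans rA.
  rewrite max_r //; exact: (@rsol_lipschitz R n (F m i) A 2 r s).
have vc i : continuous (v i) by exact: (cont_cvg_continuous UF (wv i)).
(* The delayed argument tends to [Num.max t 0]. For t >= 0 this is the undelayed source, and [rsol]
   depends on no other arguments. *)
pose G i t := g i (v (nx i) (Num.max t 0)).
have maxc : continuous (fun t : R => Num.max t 0).
  by have := @delay_continuous R 0; under eq_fun do rewrite subr0.
have Gc i : continuous (G i).
  exact: (continuous_compose (continuous_compose maxc (vc (nx i))) (gc i)).
have FG i : cont_cvg U (fun m => F m i) (G i).
  apply: (@cont_cvg_near R U _ (fun m t =>
      g i (w m (nx i) (Num.max (t - m.+1%:R^-1) 0)) + m.+1%:R^-1)).
    move=> A; apply: filterS (largeU A) => m Am s sA.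
    by have [_ _ _ _ H] := HZ m; apply: H; lra.
  have -> : G i = fun t => G i t + 0 by apply/funext => t; rewrite addr0.
  apply: cont_cvgD; last exact: cont_cvg_cst.
  apply: (@cont_cvg_comp R U (fun m t => w m (nx i) (Num.max (t - m.+1%:R^-1) 0))) => //.
  apply: (@cont_cvg_arg R U (fun m => w m (nx i)) (v (nx i))
    (fun m t => Num.max (t - m.+1%:R^-1) 0) (fun t => Num.max t 0)) => //.
  move=> t e e0; have e2 : 0 < e / 2 by lra.
  exists (e / 2) => //; move/cvgrPdist_le : epsU => /(_ _ e2); apply: filterS => m.
  rewrite sub0r normrN ger0_norm // => h s st.
  have h0 : (0 : R) <= m.+1%:R^-1 by [].
  move: (m.+1%:R^-1) h h0 => E h h0.
  by apply: le_trans (delay_dist s t h0) _; lra.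
have vE i r : v i r = al i - rsol n (fun t => g i (v (nx i) t)) r.
  have -> : rsol n (fun t => g i (v (nx i) t)) r = rsol n (G i) r.
    apply: rsol_eq => //; first exact: continuous_compose.
    by move=> t /andP[t0 _]; rewrite /G max_l.
  have cF : cont_cvg U (fun m => rsol n (F m i)) (rsol n (G i)).
    exact: cont_cvg_rsol.
  have cr : (fun m => a m i - rsol n (F m i) r) @ U --> al i - rsol n (G i) r.
    apply: cvgB; first by case: (Hal i).
    exact: (@cont_cvg_cvg R U (fun m => rsol n (F m i))).
  by apply: (cvg_near_eq UF (Hv i r) cr); apply: nearW.
exists al, v; split=> //.
(* If the stopping radii stay bounded along [U], they converge to a common zero, because they are
   eventually below m+1 and so [c m = 0]. If not, they exceed any given [r] for almost all [m], and
   all components are nonnegative at [r]. *)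
have [[A HA]|nA] := pselect (exists A, \forall m \near U, T m <= A); [left|right].
  have Tb : \forall m \near U, 0 <= T m <= A.
    apply: filterS HA => m ->.
    by have [_ [/andP[->]]] := HZ m.
  have [S /andP[S0 _] TS] := ultra_bounded_cvg UU Tb.
  have vS i : v i S = 0.
    have wT : w m i (T m) @[m --> U] --> v i S.
      exact: (@cont_cvg_point R U (fun m => w m i) (v i) T S _ (wv i) TS).
    apply: (cvg_near_eq UF wT (Ucst 0)).
    apply: filterS2 HA (largeU A) => m h1 h2.
    by have [_ [_ _ -> [//|h]]] := HZ m; lra.
  (* At [S = 0] all initial values would vanish, against their sum 1. *)
  exists S => //; rewrite lt_neqAle S0 andbT; apply/eqP => S00.
  have : \sum_i al i = 0.
    apply: big1 => i _.
    have := vE i 0; rewrite (rsol0 n (continuous_compose (vc (nx i)) (gc i))) subr0.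
    by rewrite {1}S00 vS => <-.
  by case: als => _ ->; apply/eqP; rewrite oner_eq0.
move=> i r r0; have [h|h] := in_ultra_setVsetC [set m | T m <= r] UU.
  by case: nA; exists r.
apply: (cvg_le UF (Ucst 0) (Hv i r)); apply: filterS h => m /= /negP; rewrite -ltNge => rT.
have [_ [_ c0 wT _] [_ wd] _ _] := HZ m.
by rewrite (le_trans c0) // -(wT i) wd // r0 ltW.
Qed.

(** * The Pohozaev identity *)

(** If [a i = 0], component [i] can be nonnegative at [T] only if its source is 0 at the origin,
    which makes the next initial value 0 as well; around the cycle this contradicts the sum 1. Hence
    all sources are positive at the origin. *)
Lemma positive_system (R : realType) (n d : nat) (nx : 'I_d.+1 -> 'I_d.+1)
    (g : 'I_d.+1 -> R -> R) (a : 'I_d.+1 -> R) (v : 'I_d.+1 -> R -> R) (T : R) :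
  (forall i, continuous (g i)) -> (forall i y, 0 <= g i y) ->
  (forall i y, 0 < y -> 0 < g i y) ->
  (forall P : 'I_d.+1 -> Prop, (forall i, P i -> P (nx i)) -> forall i j, P i -> P j) ->
  simplex a -> (forall i, continuous (v i)) ->
  (forall i r, v i r = a i - rsol n (fun t => g i (v (nx i) t)) r) ->
  0 < T -> (forall i, 0 <= v i T) ->
  (forall i r, 0 < ravg n (fun t => g i (v (nx i) t)) r) /\
  (forall i r s, 0 <= r < s -> v i s < v i r).
Proof.
move=> gc g0 gp cyc as_ vc vE T0 vT.
have fc i : continuous (fun t => g i (v (nx i) t)) := continuous_compose (vc (nx i)) (gc i).
have v0 i : v i 0 = a i by rewrite vE (rsol0 n (fc i)) subr0.
have a0 i : 0 < a i.
  case: as_ => a_ge0 a_sum; rewrite lt_neqAle a_ge0 andbT; apply/eqP => ai0.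
  suff az j : a j = 0.
    by move: a_sum; rewrite big1 // => /eqP; rewrite eq_sym oner_eq0.
  apply: (cyc (fun j => a j = 0) _ i) => // {ai0}i ai.
  apply/eqP; rewrite -[_ == _]negbK; apply/negP => nai.
  have anx : 0 < a (nx i) by rewrite lt_neqAle a_ge0 eq_sym nai.
  have := @rsol_incr R n _ 0 T (fc i) (fun t _ => g0 i _).
  rewrite v0 lexx T0 (rsol0 n (fc i)) => /(_ (gp _ _ anx) isT).
  by have := vT i; rewrite vE ai; lra.
have f0 i : 0 < g i (v (nx i) 0) by rewrite v0 gp.
split=> [i r|i r s rs]; first exact: ravg_gt0.
by rewrite !vE ltrD2l ltrN2; apply: rsol_incr rs.
Qed.

(** Truncation gives a continuous source on the whole line, so that components can be followed
    beyond their zeros. *)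
Definition ppow (R : realType) (p y : R) : R := Num.max y 0 `^ p.

Lemma ppow_continuous (R : realType) (p : R) : 0 < p -> continuous (ppow p).
Proof.
move=> p0 y; have [y0|y0|->] := ltgtP y 0.
- rewrite /continuous_at; have -> : ppow p y = 0.
    by rewrite /ppow max_r ?ltW // powR0 // lt0r_neq0.
  apply: (@cvg_trans _ ((fun=> 0 : R) @ y)); last exact: (@cst_continuous R R 0 y).
  apply: near_eq_cvg; have N : \forall z \near y, z < 0 by exact (lt_nbhsl y0).
  near=> z; have z0 : z < 0 by near: z; exact: N.
  by rewrite /ppow max_r ?ltW // powR0 // lt0r_neq0.
- rewrite /continuous_at; have -> : ppow p y = y `^ p by rewrite /ppow max_l // ltW.
  apply: (@cvg_trans _ ((fun z => z `^ p) @ y)).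
    apply: near_eq_cvg; have N : \forall z \near y, 0 < z by exact (lt_nbhsr y0).
    near=> z; have z0 : 0 < z by near: z; exact: N.
    by rewrite /ppow max_l // ltW.
  exact: is_derive_continuous (is_derive1_powR p y0).
apply/cvgrPdist_le => e e0; apply/nbhs_ballP; exists (e `^ p^-1) => /=.
  exact: powR_gt0.
move=> z; rewrite /ball /= sub0r normrN => ze.
rewrite /ppow max_l // powR0 ?lt0r_neq0 // sub0r normrN ger0_norm ?powR_ge0 //.
have -> : e = (e `^ p^-1) `^ p by rewrite -powRrM mulVf ?lt0r_neq0 // powRr1 // ltW.
apply: ge0_ler_powR; rewrite ?nnegrE ?powR_ge0 ?le_max ?lexx ?orbT //; first exact: ltW.
by rewrite ge_max powR_ge0 andbT; apply: le_trans (ler_norm z) (ltW ze).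
Unshelve. all: by end_near.
Qed.

Lemma derive_ppow (R : realType) (p : R) (w : R -> R) (x dw : R) :
  0 < w x -> is_derive x 1 w dw ->
  is_derive x 1 (fun t => ppow p (w t)) (p * w x `^ (p - 1) * dw).
Proof.
move=> wx wd.
have D := is_derive1_comp (is_derive1_powR p wx) wd.
apply: near_eq_is_derive D; near=> t.
have : 0 < w t by near: t; apply: (cvgr_gt (w x)) => //; exact: is_derive_continuous wd.
by move=> wt; rewrite /ppow max_l // ltW.
Unshelve. all: by end_near.
Qed.

(** Since w' = -r G, the function differentiated is r^N w1' w2' + r^(N-1) (c w1' w2 + d w1 w2') with
    N = n+1. The condition c + d = N - 2 is what cancels the terms in w1' w2'. *)
Lemma derive_pair (R : realType) (n : nat) (f1 f2 w1 w2 : R -> R) (c d r : R) :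
  continuous f1 -> continuous f2 -> 0 < r -> c + d = n.+1%:R - 2 ->
  is_derive r 1 w1 (- (r * ravg n f1 r)) -> is_derive r 1 w2 (- (r * ravg n f2 r)) ->
  is_derive r 1 (fun t => t ^+ n.+3 * (ravg n f1 t * ravg n f2 t) -
      t ^+ n.+1 * (c * (ravg n f1 t * w2 t) + d * (w1 t * ravg n f2 t)))
    (r ^+ n.+2 * (f1 r * ravg n f2 r + ravg n f1 r * f2 r) -
     r ^+ n * (c * (f1 r * w2 r) + d * (w1 r * f2 r))).
Proof.
move=> f1c f2c r0 cd w1d w2d; have rn0 := lt0r_neq0 r0.
have G1 := is_derive_ravg n f1c r0; have G2 := is_derive_ravg n f2c r0.
have D1 := derive_mul (derive_pow n.+2 r) (derive_mul G1 G2).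
have D2 := derive_mul (derive_pow n r) (derive_add (derive_scale c (derive_mul G1 w2d))
  (derive_scale d (derive_mul w1d G2))).
apply: is_derive_eq (derive_sub D1 D2) _.
have -> : d = n.+1%:R - 2 - c by rewrite -cd; ring.
have -> : n.+3%:R = n.+1%:R + 2 :> R by rewrite -natrD addn2.
rewrite !exprS; field; exact: rn0.
Qed.

Definition pair_term (R : realType) (n : nat) (f1 f2 w1 w2 : R -> R) (c d t : R) : R :=
  t ^+ n.+3 * (ravg n f1 t * ravg n f2 t) -
  t ^+ n.+1 * (c * (ravg n f1 t * w2 t) + d * (w1 t * ravg n f2 t)).

(* The radial Pohozaev function of the polyharmonic system: component [i] is
   paired with component [2K+1-i], and the weights [e + 2i] make the
   derivatives of the interior terms cancel. *)
Definition pohozaev (R : realType) (n K : nat) (f w : nat -> R -> R) (e : R)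
    (j : nat) (t : R) : R :=
  \sum_(i < j.+1) pair_term n (f i) (f (K.*2.+1 - i)%N) (w i) (w (K.*2.+1 - i)%N)
     (n.+1%:R - 2 - (e + 2 * i%:R)) (e + 2 * i%:R) t +
  \sum_(i < j) t ^+ n.+1 * (w i.+1 t * w (K.*2.+1 - i)%N t).

(** From [j] to [j.+1], what pair [j] leaves on its inner side and what pair [j.+1] brings on its
    outer side involve the same two components, j+1 and 2K+1-j. With weights growing by 2 they add
    up to minus the derivative of the product term that is added, so only the innermost and
    outermost sources remain. *)
Lemma derive_pohozaev (R : realType) (n K : nat) (f w : nat -> R -> R) (e r : R) (j : nat) :
  (forall i, continuous (f i)) ->
  (forall i (t : R), is_derive t 1 (w i) (- (t * ravg n (f i) t))) ->
  (forall i, (i <= K.*2.+1)%N -> i != K -> i != K.*2.+1 -> f i r = w i.+1 r) ->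
  (j <= K)%N -> 0 < r ->
  is_derive r 1 (pohozaev n K f w e j)
    (r ^+ n.+2 * (f j r * ravg n (f (K.*2.+1 - j)%N) r) -
     r ^+ n * ((n.+1%:R - 2 - (e + 2 * j%:R)) * (f j r * w (K.*2.+1 - j)%N r)) +
     (r ^+ n.+2 * (ravg n (f 0) r * f K.*2.+1 r) -
      r ^+ n * (e * (w 0 r * f K.*2.+1 r)))).
Proof.
move=> fc wd fw jK r0.
have PD i : is_derive r 1 (pair_term n (f i) (f (K.*2.+1 - i)%N) (w i) (w (K.*2.+1 - i)%N)
     (n.+1%:R - 2 - (e + 2 * i%:R)) (e + 2 * i%:R)) _ :=
  derive_pair (fc i) (fc (K.*2.+1 - i)%N) r0 (subrK _ _) (wd i r) (wd (K.*2.+1 - i)%N r).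
elim: j jK => [|j IH] jK.
  have -> : pohozaev n K f w e 0 = pair_term n (f 0) (f (K.*2.+1 - 0)%N) (w 0)
     (w (K.*2.+1 - 0)%N) (n.+1%:R - 2 - (e + 2 * 0%:R)) (e + 2 * 0%:R).
    by apply/funext => t; rewrite /pohozaev big_ord_recl !big_ord0 !addr0.
  apply: is_derive_eq (PD 0) _.
  by rewrite subn0 mulr0 addr0; ring.
have -> : pohozaev n K f w e j.+1 = fun t => pohozaev n K f w e j t +
    (pair_term n (f j.+1) (f (K.*2.+1 - j.+1)%N) (w j.+1) (w (K.*2.+1 - j.+1)%N)
     (n.+1%:R - 2 - (e + 2 * j.+1%:R)) (e + 2 * j.+1%:R) t +
     t ^+ n.+1 * (w j.+1 t * w (K.*2.+1 - j)%N t)).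
  apply/funext => t; rewrite /pohozaev big_ord_recr [X in _ + X]big_ord_recr /=; ring.
have DB := derive_mul (derive_pow n r) (derive_mul (wd j.+1 r) (wd (K.*2.+1 - j)%N r)).
apply: is_derive_eq (derive_add (IH (ltnW jK)) (derive_add (PD j.+1) DB)) _.
have E1 : f j r = w j.+1 r by apply: fw; lia.
have E2 : f (K.*2.+1 - j.+1)%N r = w (K.*2.+1 - j)%N r.
  rewrite fw; [|lia|lia|lia]; congr (w _ r); lia.
by rewrite E1 E2 !exprS -[j.+1%:R]natr1; ring.
Qed.

Lemma pohozaev_continuous (R : realType) (n K : nat) (f w : nat -> R -> R) (e : R) (j : nat) :
  (forall i, continuous (f i)) -> (forall i, continuous (w i)) ->
  continuous (pohozaev n K f w e j).
Proof.
move=> fc wc t.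
have gc i : {for t, continuous (ravg n (f i))} by exact: ravg_continuous.
have pc m : {for t, continuous (fun t : R => t ^+ m)} by exact: exprn_continuous.
have cc (x : R) : {for t, continuous (fun _ : R => x)} by exact: cst_continuous.
have M (u v : R -> R) : {for t, continuous u} -> {for t, continuous v} ->
  {for t, continuous (fun t => u t * v t)} by move=> uc vc; exact: cvgM.
have D (u v : R -> R) : {for t, continuous u} -> {for t, continuous v} ->
  {for t, continuous (fun t => u t + v t)} by move=> uc vc; exact: cvgD.
have S m (u : 'I_m -> R -> R) : (forall i, {for t, continuous (u i)}) ->
    {for t, continuous (fun t => \sum_(i < m) u i t)}.
  by move=> uc; apply: cvg_big => [|i _]; [exact: add_continuous|exact: uc].
rewrite /pohozaev; apply: (D); apply: (S) => i; last by apply: (M _ _ (pc _)); apply: (M); exact: wc.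
rewrite /pair_term; apply: (D); first by apply: (M _ _ (pc _)); apply: (M).
have N (u : R -> R) : {for t, continuous u} -> {for t, continuous (fun t => - u t)}.
  by move=> uc; exact: cvgN.
apply: N; apply: (M _ _ (pc _)); apply: (D).
  by apply: (M _ _ (cc _)); apply: (M _ _ (gc _)); exact: wc.
by apply: (M _ _ (cc _)); apply: (M _ _ _ (gc _)); exact: wc.
Qed.

(** [E] adds the primitives of the two powers. The choice e = N/(q+1), N = n+1, removes the power of
    [w 0] from the derivative of [H], and the coefficient left on the power of [w K.+1] is
    nonnegative by the hypothesis on p and q. So [H] cannot fall below its value 0 at the origin,
    yet [H T < 0], which also settles the critical case. *)
Lemma no_simultaneous_zero (R : realType) (n K : nat) (p q T : R) (f w : nat -> R -> R) :
  0 < p -> 0 < q -> 0 < T ->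
  n.+1%:R / (p + 1) + n.+1%:R / (q + 1) <= n.+1%:R - 2 * K.+1%:R ->
  (forall i, continuous (f i)) ->
  (forall i (t : R), is_derive t 1 (w i) (- (t * ravg n (f i) t))) ->
  (forall i t, 0 < t < T -> (i <= K.*2.+1)%N -> i != K -> i != K.*2.+1 ->
    f i t = w i.+1 t) ->
  (forall t, f K t = ppow p (w K.+1 t)) -> (forall t, f K.*2.+1 t = ppow q (w 0 t)) ->
  (forall i, (i <= K.*2.+1)%N -> 0 < ravg n (f i) T) ->
  (forall i t, 0 <= t < T -> 0 < w i t) ->
  (forall i, (i <= K.*2.+1)%N -> w i T = 0) -> False.
Proof.
move=> p0 q0 T0 pq fc wd fw fK fq GT wpos wT.
have p1 : 0 < p + 1 by lra.
have q1 : 0 < q + 1 by lra.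
have wc i : continuous (w i) by move=> t; exact: is_derive_continuous (wd i t).
pose e := n.+1%:R / (q + 1).
pose E (t : R) := t ^+ n.+1 * ((p + 1)^-1 * ppow (p + 1) (w K.+1 t) +
  (q + 1)^-1 * ppow (q + 1) (w 0 t)).
pose H (t : R) := - (pohozaev n K f w e K t + E t).
have Hc : continuous H.
  move=> t; apply: cvgN; apply: cvgD; first exact: pohozaev_continuous.
  have P (s : R) i : 0 < s -> {for t, continuous (fun t => ppow s (w i t))}.
    by move=> s0; exact: (continuous_compose (wc i) (ppow_continuous s0)).
  apply: cvgM; first exact: exprn_continuous.
  by apply: cvgD; apply: cvgM; (try exact: cvg_cst); exact: P.
have H0 : H 0 = 0.
  rewrite /H /E /pohozaev !big1 => [|i _|i _]; rewrite /pair_term ?expr0n ?mul0r; lra.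
have pT i c d : (i <= K)%N -> 0 < pair_term n (f i) (f (K.*2.+1 - i)%N) (w i)
    (w (K.*2.+1 - i)%N) c d T.
  move=> iK; rewrite /pair_term (wT i) ?(wT (K.*2.+1 - i)%N); [|lia|lia].
  rewrite !(mulr0, mul0r, addr0, subr0).
  by apply: mulr_gt0; [exact: exprn_gt0|apply: mulr_gt0; apply: GT; lia].
have HT : H T < 0.
  rewrite /H /E (wT K.+1) ?(wT 0%N) //; last by lia.
  rewrite /ppow max_l // !powR0 ?lt0r_neq0 // !mulr0 !addr0 mulr0 addr0 oppr_lt0.
  rewrite /pohozaev [X in _ + X]big1 ?addr0 => [|i _]; last first.
    by rewrite wT ?mul0r ?mulr0 //; have := ltn_ord i; lia.
  rewrite big_ord_recl; apply: ltr_pwDl; first exact: pT.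
  by apply: sumr_ge0 => i _; apply/ltW/pT; exact: ltn_ord.
suff : H 0 <= H T by lra.
have D (t : R) : 0 < t < T -> is_derive t 1 H (t ^+ n * (
    (n.+1%:R - 2 * K.+1%:R - e - n.+1%:R / (p + 1)) * w K.+1 t `^ (p + 1))).
  move=> tT; have [t0 _] := andP tT.
  have wK : 0 < w K.+1 t by apply: wpos; lra.
  have w0 : 0 < w 0 t by apply: wpos; lra.
  have D1 := derive_pohozaev e fc wd (fun i => fw i t tT) (leqnn K) t0.
  have D2 := derive_mul (derive_pow n t) (derive_add
    (derive_scale (p + 1)^-1 (derive_ppow (p + 1) wK (wd _ t)))
    (derive_scale (q + 1)^-1 (derive_ppow (q + 1) w0 (wd _ t)))).
  apply: is_derive_eq (is_deriveN (derive_add D1 D2)) _.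
  rewrite fK fq /ppow !max_l ?(ltW wK) ?(ltW w0) // !addrK.
  have -> : (K.*2.+1 - K = K.+1)%N by rewrite -addnn -addSn addnK.
  have powD1 (x s : R) : 0 < x -> x `^ (s + 1) = x `^ s * x.
    by move=> x0; rewrite powRD ?powRr1 ?ltW //; apply/implyP => /eqP; lra.
  rewrite !powD1 // -[K.+1%:R]natr1 /e !exprS; field.
  by rewrite !lt0r_neq0.
apply: (derive_nondecr (ltW T0) (fun t _ => Hc t) D) => t /andP[t0 _].
apply: mulr_ge0; first by rewrite exprn_ge0 // ltW.
by apply: mulr_ge0; [rewrite /e; lra|exact: powR_ge0].
Qed.

(** * Regularity of radial functions *)

(* Even functions to which the operator [(1/t) d/dt] can be applied [m] times
   with continuous results; these are the C^m radial profiles. *)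
Fixpoint radial_Cm (R : realType) (m : nat) (g : R -> R) : Prop :=
  [/\ continuous g, forall t, g (- t) = g t &
   if m is m'.+1 then
     exists2 Dg : R -> R, forall t : R, is_derive t 1 g (t * Dg t) & radial_Cm m' Dg
   else True].

Lemma radial_Cm0 (R : realType) (m : nat) (g : R -> R) : radial_Cm m g -> radial_Cm 0 g.
Proof. by case: m => // m []. Qed.

Lemma radial_CmW (R : realType) (m : nat) (g : R -> R) : radial_Cm m.+1 g -> radial_Cm m g.
Proof.
elim: m g => [|m IH] g; first exact: radial_Cm0.
by move=> [gc ge [Dg gd /IH Dgs]]; split=> //; exists Dg.
Qed.

Lemma radial_Cm_cst (R : realType) (m : nat) (c : R) : radial_Cm m (fun=> c).
Proof.
elim: m c => [|m IH] c; split=> //; try exact: cst_continuous.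
by exists (fun=> 0) => // t; rewrite mulr0; exact: is_derive_cst.
Qed.

Lemma radial_CmD (R : realType) (m : nat) (f g : R -> R) :
  radial_Cm m f -> radial_Cm m g -> radial_Cm m (fun t => f t + g t).
Proof.
elim: m f g => [|m IH] f g [fc fe fD] [gc ge gD]; split.
- by move=> t; apply: cvgD; [exact: fc|exact: gc].
- by move=> t; rewrite fe ge.
- by [].
- by move=> t; apply: cvgD; [exact: fc|exact: gc].
- by move=> t; rewrite fe ge.
case: fD gD => Df fd Dfs [Dg gd Dgs]; exists (fun t => Df t + Dg t); last exact: IH.
by move=> t; rewrite mulrDr; exact: derive_add.
Qed.

Lemma radial_CmM (R : realType) (m : nat) (f g : R -> R) :
  radial_Cm m f -> radial_Cm m g -> radial_Cm m (fun t => f t * g t).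
Proof.
elim: m f g => [|m IH] f g fS gS; have [fc fe fD] := fS; have [gc ge gD] := gS; split.
- by move=> t; apply: cvgM; [exact: fc|exact: gc].
- by move=> t; rewrite fe ge.
- by [].
- by move=> t; apply: cvgM; [exact: fc|exact: gc].
- by move=> t; rewrite fe ge.
case: fD gD => Df fd Dfs [Dg gd Dgs]; exists (fun t => Df t * g t + f t * Dg t).
  by move=> t; apply: is_derive_eq (derive_mul (fd t) (gd t)) _; ring.
by apply: radial_CmD; apply: IH => //; exact: radial_CmW.
Qed.

(** Positivity keeps the power away from its singularity at 0, so exponents below 1 cost no
    smoothness. *)
Lemma radial_Cm_powR (R : realType) (m : nat) (w : R -> R) (s : R) :
  (forall t, 0 < w t) -> radial_Cm m w -> radial_Cm m (fun t => w t `^ s).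
Proof.
move=> w0; elim: m s => [|m IH] s wS; have [wc we wD] := wS.
  split=> // [t|t]; last by rewrite we.
  by have := continuous_comp (wc t) (is_derive_continuous (is_derive1_powR s (w0 t))).
split.
- by move=> t; have := continuous_comp (wc t) (is_derive_continuous (is_derive1_powR s (w0 t))).
- by move=> t; rewrite we.
case: wD => Dw wd Dws; exists (fun t => s * w t `^ (s - 1) * Dw t).
  move=> t; apply: is_derive_eq (is_derive1_comp (is_derive1_powR s (w0 t)) (wd t)) _.
  ring.
apply: radial_CmM => //; apply: (@radial_CmM _ _ (fun=> s)); first exact: radial_Cm_cst.
exact/IH/radial_CmW.
Qed.

(** Integration by parts of t^n f(t): since f' = t [Df], the remaining integral has weight t^(n+2),
    hence the shift of the index by two. *)
Lemma ravg_by_parts (R : realType) (n : nat) (f Df : R -> R) (t : R) :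
  continuous f -> continuous Df -> (forall t : R, is_derive t 1 f (t * Df t)) ->
  (forall t, f (- t) = f t) ->
  n.+1%:R * ravg n f t = f t - t ^+ 2 * ravg n.+2 Df t.
Proof.
move=> fc Dfc fd fe.
wlog t0 : t / 0 <= t.
  move=> H; have [t0|t0] := leP 0 t; first exact: H.
  by rewrite -ravgN -fe -[ravg _ _ t]ravgN -sqrrN; apply: H; rewrite oppr_ge0 ltW.
have [->|tn0] := eqVneq t 0.
  by rewrite /ravg eqxx expr0n mul0r subr0 mulrCA divff ?mulr1 // pnatr_eq0.
have D (x : R) : is_derive x 1 (fun t => n.+1%:R * flux n f t + flux n.+2 Df t)
    (n.+1%:R * x ^+ n * f x + x ^+ n.+1 * (x * Df x)).
  apply: is_derive_eq (derive_add (derive_scale _ (is_derive_flux n x fc))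
    (is_derive_flux n.+2 x Dfc)) _; rewrite !exprS; ring.
have := @derive_same R (fun t => t ^+ n.+1 * f t) _ _ 0 t t0
  (fun x _ => derive_mul (derive_pow n x) (fd x)) (fun x _ => D x).
rewrite !flux0 // expr0n mul0r mulr0 addr0 !subr0 -!ravgE // => E.
have tn : t ^+ n.+1 != 0 by rewrite expf_neq0.
by apply: (mulfI tn); rewrite mulrBr E !exprS; ring.
Qed.

(** The operator (1/t) d/dt turns averages in dimension n+1 into averages of [Df] in dimension n+3.
    This is how averaging preserves smoothness at the origin. *)
Lemma is_derive_ravg_radial (R : realType) (n : nat) (f Df : R -> R) (t : R) :
  continuous f -> continuous Df -> (forall t : R, is_derive t 1 f (t * Df t)) ->
  (forall t, f (- t) = f t) ->
  is_derive t 1 (ravg n f) (t * ravg n.+2 Df t).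
Proof.
move=> fc Dfc fd fe; have N0 : (n.+1%:R : R) != 0 by rewrite pnatr_eq0.
have parts s := @ravg_by_parts R n f Df s fc Dfc fd fe.
have pos (s : R) : 0 < s -> is_derive s 1 (ravg n f) (s * ravg n.+2 Df s).
  move=> s0; apply: is_derive_eq (is_derive_ravg n fc s0) _.
  by rewrite parts; field; exact: lt0r_neq0.
have [t0|t0|->] := ltgtP t 0.
- have nt0 : 0 < - t by rewrite oppr_gt0.
  have := derive_comp_opp (pos _ nt0); rewrite mulNr opprK ravgN.
  by under eq_fun do rewrite ravgN.
- exact: pos.
have E : ravg n f = fun s => n.+1%:R^-1 * (f s - s ^+ 2 * ravg n.+2 Df s).
  by apply/funext => s; rewrite -parts mulKf.
have Rc : continuous (ravg n.+2 Df) by exact: ravg_continuous.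
have D0 : is_derive (0 : R) 1 (fun s : R => s ^+ 2 * ravg n.+2 Df s) 0.
  apply/is_derive1_caratheodory; exists (fun s => s * ravg n.+2 Df s); split.
  - by move=> z; rewrite expr0n mul0r !subr0; ring.
  - by apply: cvgM; [exact: cvg_id|exact: Rc].
  - by rewrite mul0r.
rewrite E; apply: is_derive_eq (derive_scale _ (derive_sub (fd 0) D0)) _.
by rewrite !mul0r subr0 mulr0.
Qed.

Lemma radial_Cm_ravg (R : realType) (m n : nat) (f : R -> R) :
  radial_Cm m f -> radial_Cm m (ravg n f).
Proof.
elim: m n f => [|m IH] n f [fc fe fD]; split.
- exact: ravg_continuous.
- by move=> t; rewrite ravgN.
- by [].
- exact: ravg_continuous.
- by move=> t; rewrite ravgN.
case: fD => Df fd Dfs; exists (ravg n.+2 Df); last exact: IH.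
move=> t; apply: is_derive_ravg_radial => //.
by case: (radial_Cm0 Dfs).
Qed.

Lemma radial_Cm_rsol (R : realType) (m n : nat) (f : R -> R) (a : R) :
  radial_Cm m f -> radial_Cm m.+1 (fun t => a - rsol n f t).
Proof.
move=> fS; have [fc fe _] := radial_Cm0 fS; split.
- by move=> t; apply: cvgB; [exact: cvg_cst|exact: rsol_continuous].
- by move=> t; rewrite rsolN.
exists (fun t => -1 * ravg n f t).
  move=> t; apply: is_derive_eq (derive_sub (is_derive_cst a t 1) (is_derive_rsol n t fc)) _.
  ring.
by apply: (@radial_CmM _ _ (fun=> -1)); [exact: radial_Cm_cst|exact: radial_Cm_ravg].
Qed.

(** * From radial profiles to functions on R^n *)

Lemma is_derive_line (R : realType) (n : nat) (f : 'rV[R]_n -> R) (x v : 'rV[R]_n) (a : R) :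
  is_derive (0 : R) 1 (fun h : R => f (h *: v + x)) a -> is_derive x v f a.
Proof.
have E : (fun h : R => h^-1 *: (f (h *: v + x) - f x)) =
    (fun h : R => h^-1 *: (f ((h *: (1 : R) + 0) *: v + x) - f ((0 : R) *: v + x))).
  by apply/funext => h; rewrite scale0r add0r addr0 /GRing.scale /= mulr1.
move=> [d1 d2]; split.
  by move: d1; rewrite /derivable -E.
by move: d2; rewrite /derive -E.
Qed.

Lemma euclidean_norm_line (R : realType) (n : nat) (x : 'rV[R]_n) (i : 'I_n) (h : R) :
  euclidean_norm (h *: basis_vec R i + x) =
  Num.sqrt (\sum_(j < n) x 0 j ^+ 2 + h * (2 * x 0 i) + h ^+ 2).
Proof.
rewrite /euclidean_norm; congr Num.sqrt.
rewrite (bigD1 i) //= [in RHS](bigD1 i) //= !mxE !eqxx /=.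
have -> : \sum_(j < n | j != i) (h *: basis_vec R i + x) 0 j ^+ 2 =
    \sum_(j < n | j != i) x 0 j ^+ 2.
  by apply: eq_bigr => j ji; rewrite !mxE eqxx (negPf ji) /= mulr0 add0r.
by rewrite mulr1; ring.
Qed.

Lemma is_derive_radial (R : realType) (n : nat) (g Dg : R -> R) (x : 'rV[R]_n) (i : 'I_n) :
  (forall t, g (- t) = g t) -> (forall t : R, is_derive t 1 g (t * Dg t)) ->
  is_derive x (basis_vec R i) (fun y => g (euclidean_norm y))
    (x 0 i * Dg (euclidean_norm x)).
Proof.
move=> ge gd; apply: is_derive_line.
under eq_fun do rewrite euclidean_norm_line.
rewrite /euclidean_norm; set S := \sum_(j < n) x 0 j ^+ 2.
have S0 : 0 <= S by apply: sumr_ge0 => j _; exact: sqr_ge0.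
(* At the origin the norm along the line is the absolute value of [h], which is not differentiable
   at 0; evenness of [g] removes it. *)
have [SE|Sn0] := eqVneq S 0.
  have xi : x 0 i = 0.
    apply/eqP; rewrite -sqrf_eq0 eq_le sqr_ge0 andbT -[leRHS]SE.
    by rewrite /S (bigD1 i) //= lerDl sumr_ge0 // => j _; exact: sqr_ge0.
  rewrite xi mul0r SE; under eq_fun do rewrite mulr0 mulr0 add0r add0r sqrtr_sqr.
  have -> : (fun h : R => g `|h|) = g.
    by apply/funext => h; have [//|_] := ger0P h.
  by apply: is_derive_eq (gd 0) _; rewrite mul0r.
have Sp : 0 < S by rewrite lt0r Sn0.
have D1 : is_derive (0 : R) 1 (fun h : R => S + h * (2 * x 0 i) + h ^+ 2) (2 * x 0 i).
  have := derive_add (derive_add (is_derive_cst S (0 : R) 1)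
    (derive_mul (is_derive_id (0 : R) 1) (is_derive_cst (2 * x 0 i) (0 : R) 1)))
    (derive_pow 1 (0 : R)).
  move=> D; apply: is_derive_eq D _. rewrite /=. by rewrite expr1 !mulr0 !addr0 add0r mul1r.
have S1 : S + 0 * (2 * x 0 i) + 0 ^+ 2 = S by ring.
have D2 : is_derive (S + 0 * (2 * x 0 i) + 0 ^+ 2) 1 Num.sqrt (2 * Num.sqrt S)^-1.
  by rewrite S1; exact: is_derive1_sqrt.
have D3 := @is_derive1_comp R Num.sqrt (fun h => S + h * (2 * x 0 i) + h ^+ 2) 0 _ _ D2 D1.
have D4 := @is_derive1_comp R g (fun h => Num.sqrt (S + h * (2 * x 0 i) + h ^+ 2)) 0 _ _ (gd _) D3.
apply: is_derive_eq D4 _; rewrite /= S1; field.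
by rewrite sqrtr_eq0 -ltNge.
Qed.

Lemma partial_radial (R : realType) (n : nat) (g Dg : R -> R) (i : 'I_n) :
  (forall t, g (- t) = g t) -> (forall t : R, is_derive t 1 g (t * Dg t)) ->
  partial i (fun y : 'rV[R]_n => g (euclidean_norm y)) =
  (fun x => x 0 i * Dg (euclidean_norm x)).
Proof.
by move=> ge gd; apply/funext => x; case: (is_derive_radial x i ge gd).
Qed.

Lemma CmW (R : realType) (n m : nat) (f : 'rV[R]_n -> R) : Cm m.+1 f -> Cm m f.
Proof.
elim: m f => [|m IH] f; first by case.
move=> [fc fD]; split=> // i; have [fd fS] := fD i; split=> //; exact: IH.
Qed.

Lemma Cm_continuous (R : realType) (n m : nat) (f : 'rV[R]_n -> R) : Cm m f -> continuous f.
Proof. by case: m => // m []. Qed.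

Lemma Cm_cst (R : realType) (n m : nat) (c : R) : Cm m (fun _ : 'rV[R]_n => c).
Proof.
elim: m c => [|m IH] c; first exact: cst_continuous.
split=> [|i]; first exact: cst_continuous.
split; first by move=> x; exact: derivable_cst.
have -> : partial i (fun _ : 'rV[R]_n => c) = fun=> 0.
  by apply/funext => x; rewrite /partial derive_cst.
exact: IH.
Qed.

Lemma CmD (R : realType) (n m : nat) (f g : 'rV[R]_n -> R) :
  Cm m f -> Cm m g -> Cm m (fun x => f x + g x).
Proof.
have C (u v : 'rV[R]_n -> R) : continuous u -> continuous v ->
  continuous (fun x => u x + v x) by move=> uc vc x; exact: continuousD (uc x) (vc x).
elim: m f g => [|m IH] f g; first exact: C.
move=> [fc fD] [gc gD]; split=> [|i]; first exact: C.
have [fd fS] := fD i; have [gd gS] := gD i; split.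
  by move=> x; apply: derivableD; [exact: fd|exact: gd].
have -> : partial i (fun x => f x + g x) = fun x => partial i f x + partial i g x.
  by apply/funext => x; rewrite /partial -deriveD.
exact: IH.
Qed.

Lemma CmM (R : realType) (n m : nat) (f g : 'rV[R]_n -> R) :
  Cm m f -> Cm m g -> Cm m (fun x => f x * g x).
Proof.
have C (u v : 'rV[R]_n -> R) : continuous u -> continuous v ->
  continuous (fun x => u x * v x) by move=> uc vc x; exact: continuousM (uc x) (vc x).
elim: m f g => [|m IH] f g; first exact: C.
move=> fS gS; have [fc fD] := fS; have [gc gD] := gS; split=> [|i]; first exact: C.
have [fd fiS] := fD i; have [gd giS] := gD i; split.
  by move=> x; apply: derivableM; [exact: fd|exact: gd].
have -> : partial i (fun x => f x * g x) =
    fun x => f x * partial i g x + g x * partial i f x.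
  by apply/funext => x; rewrite /partial -[LHS]/('D_(basis_vec R i) (f * g) x) deriveM.
by apply: CmD; apply: IH => //; exact: CmW.
Qed.

Lemma is_derive_coord (R : realType) (n : nat) (x : 'rV[R]_n) (i j : 'I_n) :
  is_derive x (basis_vec R j) (fun y : 'rV[R]_n => y 0 i) ((i == j)%:R : R).
Proof.
apply: is_derive_line.
under eq_fun do rewrite !mxE eqxx /=.
have := derive_add (derive_mul (is_derive_id (0 : R) 1)
  (is_derive_cst ((i == j)%:R : R) (0 : R) 1)) (is_derive_cst (x 0 i) (0 : R) 1).
by move=> D; apply: is_derive_eq D _; ring.
Qed.

Lemma Cm_coord (R : realType) (n m : nat) (i : 'I_n) : Cm m (fun x : 'rV[R]_n => x 0 i).
Proof.
case: m => [|m]; first exact: coord_continuous.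
split=> [|j]; first exact: coord_continuous.
split; first by move=> x; case: (is_derive_coord x i j).
have -> : partial j (fun x : 'rV[R]_n => x 0 i) = fun=> (i == j)%:R.
  by apply/funext => x; case: (is_derive_coord x i j).
exact: Cm_cst.
Qed.

Lemma euclidean_norm_continuous (R : realType) (n : nat) :
  continuous (@euclidean_norm R n).
Proof.
suff sc : continuous (fun x : 'rV[R]_n => \sum_(i < n) x 0 i ^+ 2).
  by move=> x; apply: (continuous_comp (sc x)); exact: sqrt_continuous.
elim: (index_enum _) => [|i s IH].
  by under eq_fun do rewrite big_nil; exact: cst_continuous.
under eq_fun do rewrite big_cons.
have ic := Cm_continuous (CmM (Cm_coord R 0 i) (Cm_coord R 0 i)).
by move=> x; exact: continuousD (ic x) (IH x).
Qed.

(** A partial derivative is a coordinate times a radial function whose profile has one order less,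
    so the induction closes by the product rule. *)
Lemma Cm_radial (R : realType) (n m : nat) (g : R -> R) :
  radial_Cm m g -> Cm m (fun x : 'rV[R]_n => g (euclidean_norm x)).
Proof.
have C (u : R -> R) : continuous u -> continuous (fun x : 'rV[R]_n => u (euclidean_norm x)).
  by move=> uc x; apply: continuous_comp; [exact: euclidean_norm_continuous|exact: uc].
elim: m g => [|m IH] g [gc ge gD]; first exact: C.
case: gD => Dg gd Dgs; split=> [|i]; first exact: C.
split; first by move=> x; case: (is_derive_radial x i ge gd).
by rewrite (partial_radial i ge gd); apply: CmM; [exact: Cm_coord|exact: IH].
Qed.

(** The second partial derivatives add up to -(n+1) G minus |x|^2 times the average of [Df] two
    dimensions higher, which integration by parts identifies with -f. *)
Lemma neg_laplacian_radial (R : realType) (n : nat) (f w : R -> R) :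
  radial_Cm 1 f -> (forall t, w (- t) = w t) ->
  (forall t : R, is_derive t 1 w (- (t * ravg n f t))) ->
  neg_laplacian (fun x : 'rV[R]_n.+1 => w (euclidean_norm x)) =
  (fun x => f (euclidean_norm x)).
Proof.
move=> [fc fe [Df fd [Dfc _ _]]] we wd; apply/funext => x.
have wd' (t : R) : is_derive t 1 w (t * (- ravg n f t)) by rewrite mulrN.
have Ge t : - ravg n f (- t) = - ravg n f t by rewrite ravgN.
have Gd (t : R) : is_derive t 1 (fun t => - ravg n f t) (t * (- ravg n.+2 Df t)).
  rewrite mulrN; apply: is_deriveN; exact: is_derive_ravg_radial.
rewrite /neg_laplacian /laplacian.
have P i : partial i (partial i (fun x : 'rV[R]_n.+1 => w (euclidean_norm x))) x =
    - ravg n f (euclidean_norm x) - x 0 i ^+ 2 * ravg n.+2 Df (euclidean_norm x).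
  rewrite (partial_radial i we wd').
  have Dc := is_derive_coord x i i; have Dr := is_derive_radial x i Ge Gd.
  have := is_deriveM Dc Dr; rewrite eqxx /GRing.scale /= => -[_].
  by rewrite /partial => ->; ring.
under eq_bigr do rewrite P.
rewrite big_split /= sumr_const card_ord sumrN -mulr_suml opprD opprK.
rewrite -mulNrn opprK -[_ *+ _]mulr_natl ravg_by_parts //.
rewrite /euclidean_norm sqr_sqrtr ?subrK // sumr_ge0 // => i _; exact: sqr_ge0.
Qed.

(** * Entire solutions *)

Lemma cyclic_successor (d : nat) (P : 'I_d.+1 -> Prop) :
  (forall i : 'I_d.+1, P i -> P (inord (i.+1 %% d.+1))) -> forall i j, P i -> P j.
Proof.
move=> PS i j Pi.
have H m : P (inord ((i + m) %% d.+1)).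
  elim: m => [|m IH]; first by rewrite addn0 modn_small // inord_val.
  by have := PS _ IH; rewrite inordK ?ltn_pmod // -addn1 modnDml addn1 addnS.
have := H (d.+1 - i + j)%N; rewrite addnA subnKC; last exact: ltnW.
by rewrite modnDl modn_small // inord_val.
Qed.

Lemma decay_source (R : realType) (n : nat) (f : R -> R) (a c : R) :
  continuous f -> 0 < c -> (forall t, 0 <= t -> c <= f t) ->
  exists2 r, 0 <= r & a - rsol n f r < 0.
Proof.
move=> fc c0 cf; pose c' := c / n.+1%:R.
have c'0 : 0 < c' by rewrite divr_gt0.
(* From radius 1 on, [rsol] has slope at least [c'], so at this [r] it is at least [c'] plus the
   absolute value of [a]. *)
pose r := 2 + `|a| / c'.
have q0 : 0 <= `|a| / c' by rewrite divr_ge0 // ltW.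
have D (x : R) : is_derive x 1 (fun t => rsol n f t - c' * t) (x * ravg n f x - c' * 1).
  exact: derive_sub (is_derive_rsol n x fc) (derive_scale c' (is_derive_id x 1)).
have r1 : 1 <= r by rewrite /r; lra.
have : rsol n f 1 - c' * 1 <= rsol n f r - c' * r.
  apply: (@derive_nondecr _ _ _ 1 r r1 _ (fun x _ => D x)) => x xr.
    exact: is_derive_continuous (D x).
  have h : c' <= ravg n f x.
    rewrite /c' -(ravg_cst n c x); apply: (@ravg_le _ _ _ _ `|x|) => //.
      exact: cst_continuous.
    by move=> t /andP[t0 _]; exact: cf.
  by nra.
have : 0 <= rsol n f 1.
  by apply: rsol_ge0 => // t t0; apply: le_trans (cf t t0); exact: ltW.
move=> h1 h2; exists r; first lra.
have cr : c' * r = c' * 2 + `|a| by rewrite /r mulrDr mulrCA divff ?mulr1 // lt0r_neq0.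
by have := ler_norm a; lra.
Qed.

Lemma ppow_ub (R : realType) (s y : R) : 0 < s -> y <= 1 -> ppow s y <= 1.
Proof.
move=> s0 y1; have -> : 1 = (1 : R) `^ s by rewrite powR1.
rewrite /ppow.
by apply: ge0_ler_powR; rewrite ?nnegrE ?le_max ?lexx ?orbT ?ge_max ?y1 ?ler01 // ltW.
Qed.

(* Components 0, ..., K are the (-Delta)^i u and components K+1, ..., 2K+1 the
   (-Delta)^i v, where K+1 is the k of the theorem. *)
Definition exponent (R : realType) (K : nat) (p q : R) (i : nat) : R :=
  if i == K then p else if i == K.*2.+1 then q else 1.

Lemma radial_solution (R : realType) (n K : nat) (p q : R) :
  0 < p -> 0 < q ->
  n.+1%:R / (p + 1) + n.+1%:R / (q + 1) <= n.+1%:R - 2 * K.+1%:R ->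
  exists v : nat -> R -> R,
    [/\ v K.*2.+2 = v 0, forall i t, 0 < v i t, forall m i, radial_Cm m (v i),
     forall i (t : R), (i <= K.*2.+1)%N ->
       is_derive t 1 (v i) (- (t * ravg n (fun s => v i.+1 s `^ exponent K p q i) t)) &
     forall i e, (i <= K.*2.+1)%N -> 0 < e ->
       exists M, forall t, M < t -> v i.+1 t < e].
Proof.
move=> p0 q0 pq; pose D := K.*2.+1.
pose nx (i : 'I_D.+1) : 'I_D.+1 := inord (i.+1 %% D.+1).
pose g (i : 'I_D.+1) := ppow (exponent K p q i).
have s0 i : 0 < exponent K p q i by rewrite /exponent; case: ifP => // _; case: ifP.
have gc i : continuous (g i) by exact: ppow_continuous.
have g0 i y : 0 <= g i y by exact: powR_ge0.
have g1 i y : y <= 1 -> g i y <= 1 by exact: ppow_ub.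
have gp i y : 0 < y -> 0 < g i y by move=> y0; rewrite powR_gt0 // lt_max y0.
have [a [v [as_ vc vE alt]]] := @limit_of_shots R n D nx g gc g0 g1.
have fc i : continuous (fun t => g i (v (nx i) t)) := continuous_compose (vc (nx i)) (gc i).
have vd i (t : R) : is_derive t 1 (v i) (- (t * ravg n (fun t => g i (v (nx i) t)) t)).
  have -> : v i = fun t => a i - rsol n (fun t => g i (v (nx i) t)) t.
    by apply/funext => s; exact: vE.
  by rewrite -[X in is_derive _ _ _ X]sub0r; apply: derive_sub; exact: is_derive_rsol.
have pos T := @positive_system R n D nx g a v T gc g0 gp (@cyclic_successor D) as_ vc vE.
have nxE i : (i < D)%N -> nx (inord i) = inord i.+1.
  by move=> iD; rewrite /nx inordK ?modn_small // ltnW.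
case: alt => [[T T0 vT]|v0].
  exfalso; have [Gp vdec] := pos T T0 (fun i => eq_ind_r (fun x => 0 <= x) (lexx 0) (vT i)).
  apply: (@no_simultaneous_zero R n K p q T
    (fun i => fun t => g (inord i) (v (nx (inord i)) t)) (fun i => v (inord i))) => //.
  - move=> i t /andP[t0 tT] iD iK iD'.
    have iD1 : (i < D)%N by rewrite ltn_neqAle iD'.
    rewrite nxE // /g /ppow /exponent inordK ?ltnS // (negPf iK) (negPf iD').
    have : v (inord i.+1) T < v (inord i.+1) t by apply: vdec; rewrite ltW.
    by rewrite vT => /ltW h; rewrite max_l // powRr1.
  - move=> t; rewrite nxE; last by rewrite /D; lia.
    by rewrite /g /exponent inordK ?eqxx // ltnS; lia.
  - move=> t; rewrite /nx /g /exponent inordK // modnn.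
    by rewrite ifF ?eqxx //; apply/eqP; lia.
  - by move=> i t tT; rewrite -(vT (inord i)); exact: vdec.
have [Gp vdec] := pos 1 ltr01 (fun i => v0 i 1 ler01).
have ve i t : v i (- t) = v i t by rewrite !vE rsolN.
have vpos i t : 0 < v i t.
  have P s : 0 <= s -> 0 < v i s.
    move=> s_ge0; apply: (@le_lt_trans _ _ (v i (s + 1))); first by apply: v0; lra.
    by apply: vdec; lra.
  by have [/P //|t0] := leP 0 t; rewrite -ve P // oppr_ge0 ltW.
have gE i : (fun t => g i (v (nx i) t)) = fun t => v (nx i) t `^ exponent K p q i.
  by apply/funext => t; rewrite /g /ppow max_l // ltW.
(* Bootstrap around the cycle: a positive component of order m has powers of order m, and solving
   gains one order for its predecessor. *)
have vS m i : radial_Cm m (v i).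
  elim: m i => [|m IH] i; first by split.
  have -> : v i = fun t => a i - rsol n (fun t => g i (v (nx i) t)) t.
    by apply/funext => s; exact: vE.
  by apply: radial_Cm_rsol; rewrite gE; apply: radial_Cm_powR.
(* Indices are extended to natural numbers modulo 2K+2, so that the next component is always at
   [i.+1]. *)
exists (fun i => v (inord (i %% D.+1))).
have idx i : (i <= K.*2.+1)%N -> nx (inord (i %% D.+1)) = inord (i.+1 %% D.+1).
  by move=> iD; rewrite (@modn_small i D.+1) // /nx inordK.
split.
- by rewrite modnn mod0n.
- by move=> i t; exact: vpos.
- by move=> m i; exact: vS.
- move=> i t iD; have iE : nat_of_ord (inord (i %% D.+1) : 'I_D.+1) = i.
    by rewrite inordK ?ltn_pmod ?modn_small.
  by have := vd (inord (i %% D.+1)) t; rewrite gE (idx i iD) iE.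
- move=> i e iD e0; rewrite -idx //; move: (inord (i %% D.+1)) => j.
  apply: contrapT => nM.
  have ge t : 0 <= t -> e <= v (nx j) t.
    move=> t0; rewrite leNgt; apply/negP => vt; apply: nM; exists t => s ts.
    by apply: lt_trans vt; apply: vdec; rewrite t0.
  have c0 : 0 < e `^ exponent K p q j by exact: powR_gt0.
  have [|r r0] := @decay_source R n _ (a j) _ (fc j) c0.
    move=> t /ge et; rewrite /g /ppow max_l; last exact/ltW/vpos.
    by apply: ge0_ler_powR; rewrite ?nnegrE //; exact: ltW.
  by rewrite -vE; have := v0 j r r0; lra.
Qed.

Lemma neg_laplacian_iter_radial (R : realType) (n i j : nat) (v : nat -> R -> R) :
  (forall l, (i <= l < i + j)%N ->
    neg_laplacian (fun x : 'rV[R]_n => v l (euclidean_norm x)) =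
    (fun x => v l.+1 (euclidean_norm x))) ->
  neg_laplacian_iter j (fun x : 'rV[R]_n => v i (euclidean_norm x)) =
  (fun x => v (i + j)%N (euclidean_norm x)).
Proof.
elim: j => [|j IH] H; first by rewrite addn0.
rewrite /neg_laplacian_iter iterS -/(neg_laplacian_iter j _) IH; last first.
  by move=> l lj; apply: H; lia.
by rewrite H ?addnS //; lia.
Qed.

Unset Implicit Arguments.

Theorem theorem3 (R : realType) (k n : nat) (p q : R)
  (hk : (1 <= k)%N) (hkn : (2 * k < n)%N) (hp : 0 < p) (hq : 0 < q)
  (hpq : 1 / (p + 1) + 1 / (q + 1) <= (n%:R - 2 * k%:R) / n%:R) :
  exists u v : 'rV[R]_n -> R,
    Cm (2 * k) u /\ Cm (2 * k) v /\
    (forall x, 0 < u x) /\ (forall x, 0 < v x) /\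
    (forall x, neg_laplacian_iter k u x = v x `^ p) /\
    (forall x, neg_laplacian_iter k v x = u x `^ q) /\
    vanishes_at_infinity u /\ vanishes_at_infinity v.
Proof.
case: k n hk hkn hpq => [//|K] [|n] // _ hkn hpq.
have n0 : (0 : R) < n.+1%:R by [].
have pq : n.+1%:R / (p + 1) + n.+1%:R / (q + 1) <= n.+1%:R - 2 * K.+1%:R.
  by move: hpq; rewrite ler_pdivlMr // !mul1r mulrDl [_^-1 * _]mulrC [X in _ + X]mulrC.
have [v [vper vpos vS vd vdecay]] := radial_solution hp hq pq.
have lap i : (i <= K.*2.+1)%N ->
    neg_laplacian (fun x : 'rV[R]_n.+1 => v i (euclidean_norm x)) =
    (fun x => v i.+1 (euclidean_norm x) `^ exponent K p q i).
  move=> iD; have [_ ve _] := radial_Cm0 (vS 0%N i).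
  apply: (@neg_laplacian_radial R n (fun t => v i.+1 t `^ exponent K p q i) (v i)) => //.
    exact: radial_Cm_powR.
  by move=> t; exact: vd.
have lap1 i : (i <= K.*2.+1)%N -> i != K -> i != K.*2.+1 ->
    neg_laplacian (fun x : 'rV[R]_n.+1 => v i (euclidean_norm x)) =
    (fun x => v i.+1 (euclidean_norm x)).
  move=> iD iK iD'; rewrite lap // /exponent (negPf iK) (negPf iD').
  by apply/funext => x; rewrite powRr1 // ltW.
exists (fun x => v 0%N (euclidean_norm x)), (fun x => v K.+1 (euclidean_norm x)).
have van i : (i <= K.*2.+1)%N -> vanishes_at_infinity
    (fun x : 'rV[R]_n.+1 => v i (euclidean_norm x)).
  move=> iD e e0.
  have [M HM] : exists M, forall t, M < t -> v i t < e.
    case: i iD => [|i] iD; last by apply: vdecay => //; lia.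
    by rewrite -vper; apply: vdecay.
  by exists M => x /HM h; rewrite ger0_norm // ltW // vpos.
split; first by apply/Cm_radial/vS.
split; first by apply/Cm_radial/vS.
split; first by move=> x; apply: vpos.
split; first by move=> x; apply: vpos.
split; [|split; [|split; apply: van; lia]] => x.
  (* Only the outermost Laplacian meets a power; the [K] steps before it have exponent 1. *)
  rewrite /neg_laplacian_iter iterS -/(neg_laplacian_iter K _).
  rewrite neg_laplacian_iter_radial ?add0n => [|l lK]; last by apply: lap1; lia.
  by rewrite lap /exponent ?eqxx //; lia.
rewrite /neg_laplacian_iter iterS -/(neg_laplacian_iter K _).
rewrite neg_laplacian_iter_radial => [|l lK]; last by apply: lap1; lia.
rewrite (_ : K.+1 + K = K.*2.+1)%N ?lap ?vper /exponent ?eqxx //; last by lia.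
by rewrite ifF //; apply/eqP; lia.
Qed.
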